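(* There is a polynomial-time algorithm for $\textsc{MVDSP}$ on directed graphs with non-negative edge weights whose approximation factor is $\min\{\sqrt{n},\lceil\sqrt{\ell}\rceil\}$. Here $n$ is the number of vertices and $\ell$ is the minimum total number of edges (arcs) of the paths over all optimal solutions.
   Context: $\textsc{MVDSP}$ is the following maximization problem. The input is a (directed or undirected) graph $G=(V,E)$ with $n$ vertices, an edge-length function $w\colon E\to\mathbb{Q}_{\ge 0}$, and terminal pairs $(s_1,t_1),\dots,(s_k,t_k)$ with $s_i\neq t_i$. A solution is a set $S\subseteq[k]$ together with a collection $\{P_i\}_{i\in S}$ of pairwise vertex-disjoint paths (disjoint including end vertices) where each $P_i$ is a shortest $s_i$-$t_i$-path in $G$ with respect to $w$. The goal is to maximize $|S|$. An algorithm has approximation factor $\alpha$ if it always returns a solution with $|S|\ge \mathrm{OPT}/\alpha$, where $\mathrm{OPT}$ is the maximum possible $|S|$. *)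

(* Defs.v *)
From HB Require Import structures.
From mathcomp Require Import all_boot all_order all_algebra.
From mathcomp Require Import reals.

Set Implicit Arguments.
Unset Strict Implicit.
Unset Printing Implicit Defensive.

Import Order.TTheory GRing.Theory Num.Theory.

(** A random access machine with structured control flow and logarithmic cost:
    every value read, computed or used as an address is charged its number of
    binary digits.  The memory consists of banks [0, 1, 2, ...] of registers,
    each register holding a natural number; a program names banks by literals,
    hence uses finitely many of them, while registers inside a bank are
    addressed by computed values.  Because of the logarithmic cost (which makes
    the presence of multiplication harmless), polynomial time in this model is
    polynomial time on Turing machines. *)

Definition memory := nat -> nat -> nat.

Inductive expr : Type :=
| EConst of nat
| ERead of nat & expr
| EAdd of expr & expr
| ESub of expr & expr
| EMul of expr & expr.

Inductive prog : Type :=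
| Skip
| Write of nat & expr & expr
| Seq of prog & prog
| If of expr & prog & prog
| While of expr & prog.

(** Number of binary digits; [bits 0 = 1]. *)
Definition bits (x : nat) : nat := (trunc_log 2 x).+1.

(** [ESub] is truncated subtraction. *)
Fixpoint eval (m : memory) (e : expr) : nat :=
  match e with
  | EConst c => c
  | ERead b a => m b (eval m a)
  | EAdd e1 e2 => eval m e1 + eval m e2
  | ESub e1 e2 => eval m e1 - eval m e2
  | EMul e1 e2 => eval m e1 * eval m e2
  end.

(** The operands of an operation, and the address of an [ERead], are charged in
    the recursive calls. *)
Fixpoint ecost (m : memory) (e : expr) : nat :=
  bits (eval m e) +
  match e with
  | EConst _ => 0
  | ERead _ a => ecost m a
  | EAdd e1 e2 | ESub e1 e2 | EMul e1 e2 => ecost m e1 + ecost m e2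
  end.

Definition upd (m : memory) (b a x : nat) : memory :=
  fun b' a' => if (b' == b) && (a' == a) then x else m b' a'.

(** [run c m m' t]: started in memory [m], the program [c] halts in memory [m']
    after time [t].  A test succeeds when its value is nonzero. *)
Inductive run : prog -> memory -> memory -> nat -> Prop :=
| RunSkip m : run Skip m m 1
| RunWrite b a e m :
    run (Write b a e) m (upd m b (eval m a) (eval m e)) (ecost m a + ecost m e)
| RunSeq c1 c2 m1 m2 m3 t1 t2 :
    run c1 m1 m2 t1 -> run c2 m2 m3 t2 -> run (Seq c1 c2) m1 m3 (t1 + t2)
| RunIfT e c1 c2 m m' t :
    eval m e != 0 -> run c1 m m' t -> run (If e c1 c2) m m' (ecost m e + t)
| RunIfF e c1 c2 m m' t :
    eval m e = 0 -> run c2 m m' t -> run (If e c1 c2) m m' (ecost m e + t)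
| RunWhileT e c m1 m2 m3 t1 t2 :
    eval m1 e != 0 -> run c m1 m2 t1 -> run (While e c) m2 m3 t2 ->
    run (While e c) m1 m3 (ecost m1 e + t1 + t2)
| RunWhileF e c m :
    eval m e = 0 -> run (While e c) m m (ecost m e).

(** The vertices are [0, ..., nv - 1]; the values of [wt] outside [arcs] are
    irrelevant. *)
Record instance : Type := Instance {
  nv : nat;
  arcs : {set 'I_nv * 'I_nv};
  wt : 'I_nv * 'I_nv -> rat;
  wt_ge0 : forall e, e \in arcs -> (0 <= wt e)%R;
  np : nat;
  source : 'I_np -> 'I_nv;
  target : 'I_np -> 'I_nv;
  source_neq_target : forall i, source i != target i
}.

Section Problem.
Variable I : instance.
Local Notation V := 'I_(nv I).

Definition st_path (s t : V) (p : seq V) : bool :=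
  if p is x :: q then
    [&& x == s, last x q == t, path (fun u v => (u, v) \in arcs I) x q & uniq p]
  else false.

Definition path_length (p : seq V) : rat :=
  (\sum_(e <- zip p (behead p)) wt e)%R.

(** The vertices of a path are distinct, so bounding its number of vertices by
    [nv I] loses nothing and makes paths range over a finite type. *)
Definition shortest_path (s t : V) (p : seq V) : bool :=
  st_path s t p &&
  [forall q : {bseq (nv I) of V},
     st_path s t q ==> (path_length p <= path_length q)%R].

End Problem.

(** [S i = Some p] means that pair [i] is selected and routed along the path [p],
    given by its sequence of vertices. *)
Notation solution I := {ffun 'I_(np I) -> option {bseq (nv I) of 'I_(nv I)}}.

Section Solutions.
Variable I : instance.
Implicit Type S : solution I.

Definition feasible S : bool :=
  [forall i, if S i is Some p then shortest_path (source i) (target i) p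
             else true] &&
  [forall i, forall j, (i != j) ==>
     (if (S i, S j) is (Some p, Some q) then [disjoint p & q] else true)].

Definition value S : nat := #|[set i | S i != None]|.

Definition num_arcs S : nat :=
  \sum_i (if S i is Some p then (size p).-1 else 0).

Definition opt : nat := \max_(S : solution I | feasible S) value S.

Definition optimal S : bool := feasible S && (value S == opt).

Definition empty_solution : solution I := [ffun=> None].

Definition some_optimal : solution I :=
  [arg max_(S > empty_solution | feasible S) value S].

Definition min_opt_arcs : nat :=
  num_arcs [arg min_(S < some_optimal | optimal S) num_arcs S].

Lemma feasible_empty : feasible empty_solution.
Proof.
apply/andP; split; apply/forallP => i; first by rewrite ffunE.
by apply/forallP => j; rewrite !ffunE implybT.
Qed.

Lemma optimal_some_optimal : optimal some_optimal.
Proof.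
rewrite /optimal /some_optimal; case: arg_maxnP => [|S fS maxS].
  exact: feasible_empty.
rewrite fS eqn_leq (leq_bigmax_cond _ fS) /=.
by apply/bigmax_leqP => S' /maxS.
Qed.

(** [min_opt_arcs] is the minimum of [num_arcs] over the optimal solutions. *)
Lemma min_opt_arcsP :
  (exists2 S, optimal S & num_arcs S = min_opt_arcs) /\
  (forall S, optimal S -> min_opt_arcs <= num_arcs S).
Proof.
rewrite /min_opt_arcs; case: arg_minnP => [|S oS minS].
  exact: optimal_some_optimal.
by split=> //; exists S.
Qed.

End Solutions.

(** Adjacency matrix, row by row; an arc is followed by the numerator and the
    (positive) denominator of its length. *)
Definition encode_instance (I : instance) : seq nat :=
  [:: nv I; np I] ++
  flatten [seq (if (u, v) \in arcs I
                then [:: 1; `|numq (wt (u, v))|; `|denq (wt (u, v))|]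
                else [:: 0; 0; 0])
          | u <- enum 'I_(nv I), v <- enum 'I_(nv I)] ++
  flatten [seq [:: val (source i); val (target i)] | i <- enum 'I_(np I)].

Definition input_size (I : instance) : nat :=
  \sum_(x <- encode_instance I) bits x.

(** Pair by pair: [0] for a pair that is not selected, otherwise the number of
    vertices of its path (nonzero in a feasible solution) and these vertices. *)
Definition encode_solution (I : instance) (S : solution I) : seq nat :=
  flatten [seq (if S i is Some p then size p :: [seq val v | v <- p]
                else [:: 0])
          | i <- enum 'I_(np I)].

(** The input is in bank 0, and all other registers are zero. *)
Definition init_mem (I : instance) : memory :=
  fun b a => if b == 0 then nth 0 (encode_instance I) a else 0.

(** The output is read from bank 1; the encoding is self-delimiting. *)
Definition output (I : instance) (m : memory) (S : solution I) : Prop :=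
  forall a, a < size (encode_solution S) -> m 1 a = nth 0 (encode_solution S) a.

Definition polynomial_time (c : prog) : Prop :=
  exists P : {poly nat}, forall I : instance, exists m t,
    run c (init_mem I) m t /\ t <= (P.[input_size I])%R.

(** For [alpha = min (sqrt n) (ceil (sqrt l))], [alpha I = 0] forces [opt I = 0],
    so that the convention [x / 0 = 0] is immaterial. *)
Definition approximation_factor (R : realType) (c : prog)
    (alpha : instance -> R) : Prop :=
  forall (I : instance) m t, run c (init_mem I) m t ->
    exists S : solution I,
      [/\ output m S, feasible S & ((opt I)%:R / alpha I <= (value S)%:R)%R].

(* Main.v *)
Require Import Defs.
From HB Require Import structures.
From mathcomp Require Import all_boot all_order all_algebra.
From mathcomp Require Import reals.
From mathcomp Require Import zify.

Set Implicit Arguments.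
Unset Strict Implicit.
Unset Printing Implicit Defensive.

Import Order.TTheory GRing.Theory Num.Theory.

(* The algorithm is greedy: for k = 0, 1, ..., n - 1 it scans the pairs, and routes
   every pair that is not yet selected and has a shortest path with exactly k arcs
   that avoids the vertices used so far.  Each shortest path P of the graph is then
   hit by a selected path with at most as many vertices as P.  Let an optimal
   solution have k paths and l arcs, hence k + l <= n vertices, and charge each of
   its paths to such a selected path.  A selected path q receives c(q) <= |q|
   charges, all from paths with at least |q| vertices, so the sum of the c(q) ^ 2
   is at most k + l, and k ^ 2 <= g (k + l) by Cauchy-Schwarz for the number g of
   selected paths.  This gives k <= g sqrt n and k <= g ceil(sqrt l).

   Shortest paths are found layer by layer, one layer for each number of arcs, with
   integer weights obtained by multiplying with all denominators.  For polynomial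
   time it suffices to control the number of steps and the length of the numbers.
   The latter is read off the program text: memory banks have levels, and a value
   written to a bank combines at most one value of the same level with values of
   lower levels, so that lengths grow polynomially level by level. *)

(** * Compiling bounded loops to the machine *)

(** The approximation factor speaks of every run of the program. By determinism it suffices to
    exhibit the one run that ends in the memory computed by [sem]. *)
Lemma run_deterministic c m m1 m2 t1 t2 :
  run c m m1 t1 -> run c m m2 t2 -> m1 = m2.
Proof.
move=> r1; elim: r1 m2 t2 => {c m m1 t1}.
- by move=> m m2 t2 r; inversion r.
- by move=> b a e m m2 t2 r; inversion r.
- move=> c1 c2 m1 m2 m3 t1 t2 _ IH1 _ IH2 m4 t r; inversion r; subst.
  match goal with A : run c1 _ _ _, B : run c2 _ _ _ |- _ =>
    by rewrite -(IH1 _ _ A) in B; apply: IH2 B end.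
- move=> e c1 c2 m m' t /eqP ne _ IH m2 t2 r; inversion r; subst=> //.
  by match goal with A : run c1 _ _ _ |- _ => apply: IH A end.
- move=> e c1 c2 m m' t e0 _ IH m2 t2 r; inversion r; subst.
    by match goal with A : is_true (_ != _) |- _ => rewrite e0 in A end.
  by match goal with A : run c2 _ _ _ |- _ => apply: IH A end.
- move=> e c m1 m2 m3 t1 t2 /eqP ne _ IH1 _ IH2 m4 t r; inversion r; subst=> //.
  match goal with A : run c _ _ _, B : run (While _ _) _ _ _ |- _ =>
    by rewrite -(IH1 _ _ A) in B; apply: IH2 B end.
- move=> e c m e0 m2 t2 r; inversion r; subst=> //.
  by match goal with A : is_true (_ != _) |- _ => rewrite e0 in A end.
Qed.

Lemma bits_gt0 x : 0 < bits x. Proof. by []. Qed.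

Lemma ltn_bits x : x < 2 ^ bits x.
Proof. exact: trunc_log_ltn. Qed.

Lemma bits_leq x k : 0 < k -> x < 2 ^ k -> bits x <= k.
Proof.
move=> k0 xk; rewrite /bits; case: (posnP x) => [-> | x0].
  by rewrite trunc_log0.
rewrite -(ltn_exp2l (m := 2)) //.
by apply: leq_ltn_trans xk; apply: trunc_logP.
Qed.

Lemma leq_bits x y : x <= y -> bits x <= bits y.
Proof. by move=> xy; rewrite ltnS leq_trunc_log. Qed.

Lemma bits_leqS x : bits x <= x.+1.
Proof.
apply: bits_leq => //; apply: (leq_trans (ltn_expl x (isT : 1 < 2))).
by rewrite leq_exp2l.
Qed.

Lemma bits_add x y : bits (x + y) <= bits x + bits y.
Proof.
apply: bits_leq => //; rewrite expnD.
have := ltn_bits x; have := ltn_bits y.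
have := leq_pexp2l (isT : 0 < 2) (bits_gt0 x).
have := leq_pexp2l (isT : 0 < 2) (bits_gt0 y).
rewrite expn1; move: (2 ^ _) (2 ^ _) => a b; nia.
Qed.

Lemma bits_mul x y : bits (x * y) <= bits x + bits y.
Proof.
apply: bits_leq => //; rewrite expnD.
have := ltn_bits x; have := ltn_bits y.
by move: (2 ^ _) (2 ^ _) => a b; nia.
Qed.

Lemma size_flatten_const (A : eqType) (ss : seq (seq A)) c :
  (forall l, l \in ss -> size l = c) -> size (flatten ss) = size ss * c.
Proof.
elim: ss => //= l ss IH sc; rewrite size_cat sc ?mem_head // IH // => l' l'ss.
by rewrite sc // inE l'ss orbT.
Qed.

Lemma nth_flatten_const (A : eqType) (x0 : A) (ss : seq (seq A)) c i j :
  (forall l, l \in ss -> size l = c) -> j < c -> i < size ss ->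
  nth x0 (flatten ss) (i * c + j) = nth x0 (nth [::] ss i) j.
Proof.
move=> + jc; elim: ss i => // l ss IH [|i] /= sc lti.
  by rewrite nth_cat sc ?mem_head // add0n jc.
rewrite nth_cat sc ?mem_head // mulSn -addnA ltnNge leq_addr /= addKn IH //.
by move=> l' l'ss; rewrite sc // inE l'ss orbT.
Qed.

(** All loops are bounded, so that [sem] below is a total function and correctness can be stated by
    equations instead of through [run]. *)
Inductive stmt : Type :=
| SSkip
| SWrite of nat & expr & expr
| SSeq of stmt & stmt
| SIf of expr & stmt & stmt
| SFor of nat & expr & stmt.

(** Bank [b] is private to the loop [SFor b e s]: register 0 holds the counter,
    register 1 the bound, which is evaluated once. *)
Fixpoint compile (s : stmt) : prog :=
  match s with
  | SSkip => Skip
  | SWrite b a e => Write b a e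
  | SSeq s1 s2 => Seq (compile s1) (compile s2)
  | SIf e s1 s2 => If e (compile s1) (compile s2)
  | SFor b e s =>
      Seq (Write b (EConst 1) e)
     (Seq (Write b (EConst 0) (EConst 0))
     (While (ESub (ERead b (EConst 1)) (ERead b (EConst 0)))
        (Seq (compile s)
             (Write b (EConst 0) (EAdd (ERead b (EConst 0)) (EConst 1))))))
  end.

(** [n] iterations remain and [k] are finished. Setting the counter to [k.+1] agrees with the
    compiled increment because [good] forbids the body to write to bank [b]. *)
Fixpoint loop (f : memory -> memory) (b n k : nat) (m : memory) : memory :=
  if n is n'.+1 then loop f b n' k.+1 (upd (f m) b 0 k.+1) else m.

Fixpoint sem (s : stmt) (m : memory) : memory :=
  match s with
  | SSkip => m
  | SWrite b a e => upd m b (eval m a) (eval m e)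
  | SSeq s1 s2 => sem s2 (sem s1 m)
  | SIf e s1 s2 => if eval m e != 0 then sem s1 m else sem s2 m
  | SFor b e s =>
      loop (sem s) b (eval m e) 0 (upd (upd m b 1 (eval m e)) b 0 0)
  end.

Lemma sem_seq s1 s2 m : sem (SSeq s1 s2) m = sem s2 (sem s1 m).
Proof. by []. Qed.

Lemma sem_if e s1 s2 m :
  sem (SIf e s1 s2) m = if eval m e != 0 then sem s1 m else sem s2 m.
Proof. by []. Qed.

Fixpoint mods (s : stmt) : seq nat :=
  match s with
  | SSkip => [::]
  | SWrite b _ _ => [:: b]
  | SSeq s1 s2 | SIf _ s1 s2 => mods s1 ++ mods s2
  | SFor b _ s => b :: mods s
  end.

Lemma upd_other m b a x c d : c != b -> upd m b a x c d = m c d.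
Proof. by rewrite /upd => /negPf->. Qed.

Lemma loop_frame f b c a n k m :
  c != b -> (forall m', f m' c a = m' c a) -> loop f b n k m c a = m c a.
Proof.
by move=> cb fc; elim: n k m => //= n IH k m; rewrite IH upd_other.
Qed.

Lemma sem_frame s m c a : c \notin mods s -> sem s m c a = m c a.
Proof.
elim: s m => //= [b i e|s1 IH1 s2 IH2|e s1 IH1 s2 IH2|b e s IH] m.
- by rewrite inE => cb; rewrite upd_other.
- by rewrite mem_cat negb_or => /andP[c1 c2]; rewrite IH2 ?IH1.
- by rewrite mem_cat negb_or => /andP[c1 c2]; case: ifP; rewrite ?IH2 ?IH1.
- rewrite inE negb_or => /andP[cb cs].
  by rewrite loop_frame ?upd_other // => m'; apply: IH.
Qed.

(** Invariant rule for loops. The frame condition is supplied to the step, so invariants need only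
    mention the banks that the loop changes. *)
Lemma sem_for (b : nat) e s m (P : nat -> memory -> Prop) :
  b \notin mods s ->
  P 0 (upd (upd m b 1 (eval m e)) b 0 0) ->
  (forall k m', k < eval m e -> m' b 0 = k ->
    (forall c a, c \notin b :: mods s -> m' c a = m c a) ->
    P k m' -> P k.+1 (upd (sem s m') b 0 k.+1)) ->
  P (eval m e) (sem (SFor b e s) m).
Proof.
move=> bs P0 PS /=; set m0 := upd _ _ _ _ in P0 *.
have fr0 c a : c \notin b :: mods s -> m0 c a = m c a.
  by rewrite inE negb_or => /andP[cb _]; rewrite /m0 !upd_other.
have b0 : m0 b 0 = 0 by rewrite /m0 /upd !eqxx.
suff gen n m1 k : n + k = eval m e -> P k m1 ->
    (forall c a, c \notin b :: mods s -> m1 c a = m c a) -> m1 b 0 = k ->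
    P (eval m e) (loop (sem s) b n k m1) by apply: gen => //; rewrite addn0.
elim: n m1 k => [|n IH] m1 k /=; first by rewrite add0n => ->.
move=> nk Pk fr bk; apply: IH; first by lia.
- by apply: PS => //; lia.
- move=> c a cbs; move: (cbs); rewrite inE negb_or => /andP[cb cs].
  by rewrite upd_other // sem_frame ?fr.
- by rewrite /upd !eqxx.
Qed.

(** * Polynomial running time from levels of memory banks *)

Section Cost.

Variables (lev : nat -> nat) (K L : nat).
Hypotheses (lev0 : lev 0 = 0) (levL : forall b, lev b <= L) (K10 : 10 <= K).

Fixpoint esize (e : expr) : nat :=
  match e with
  | EConst c => c.+1
  | ERead _ a => (esize a).+1
  | EAdd e1 e2 | ESub e1 e2 | EMul e1 e2 => (esize e1 + esize e2).+1
  end.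

(** Number of reads of level [j] that contribute to the magnitude of the value.
    Addresses and subtrahends do not count, and a read of a higher level counts
    twice, so as to be rejected by [good_write]. *)
Fixpoint occ (j : nat) (e : expr) : nat :=
  match e with
  | EConst _ => 0
  | ERead b _ => if lev b < j then 0 else if lev b == j then 1 else 2
  | EAdd e1 e2 | EMul e1 e2 => occ j e1 + occ j e2
  | ESub e1 _ => occ j e1
  end.

(** Positivity of the level makes the input read-only, since bank 0 has level 0. *)
Definition good_write b e := [&& 0 < lev b, occ (lev b) e <= 1 & esize e <= K].

(** Loop bounds are polynomials in the first two input registers, which hold [nv] and [np]. The
    number of iterations is thus bounded before anything is computed. *)
Fixpoint good_bound (e : expr) : bool :=
  match e with
  | EConst _ => true
  | ERead 0 (EConst a) => a <= 1
  | EAdd e1 e2 | EMul e1 e2 => good_bound e1 && good_bound e2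
  | _ => false
  end.

Fixpoint good (s : stmt) : bool :=
  match s with
  | SSkip => true
  | SWrite b a e => (esize a <= K) && good_write b e
  | SSeq s1 s2 => good s1 && good s2
  | SIf e s1 s2 => [&& esize e <= K, good s1 & good s2]
  | SFor b e s => [&& b \notin mods s, good_write b e, good_bound e & good s]
  end.

(** Sums and products at most add up lengths, and truncated subtraction never lengthens. A value of
    level [j] therefore enters with coefficient at most one, so repeated writes lengthen numbers
    additively instead of doubling their length. *)
Lemma bits_eval m j X Y e : occ j e <= 1 -> 0 < X ->
  (forall b a, lev b < j -> bits (m b a) <= X) ->
  (forall b a, lev b = j -> bits (m b a) <= Y) ->
  bits (eval m e) <= occ j e * Y + esize e * X.
Proof.
move=> + X0 mX mY; elim: e => [c|b a _|e1 IH1 e2 IH2|e1 IH1 e2 _|e1 IH1 e2 IH2] /=.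
- by move=> _; have := bits_leqS c; nia.
- case: ltngtP => // lb _.
    by have := mX b (eval m a) lb; nia.
  by have := mY b (eval m a) lb; nia.
- move=> o; have {IH1} := IH1 _; have {IH2} := IH2 _.
  by have := bits_add (eval m e1) (eval m e2); nia.
- move=> /IH1 h; have := leq_bits (leq_subr (eval m e2) (eval m e1)); nia.
- move=> o; have {IH1} := IH1 _; have {IH2} := IH2 _.
  by have := bits_mul (eval m e1) (eval m e2); nia.
Qed.

Lemma bits_eval_all m X e : 0 < X -> (forall b a, bits (m b a) <= X) ->
  bits (eval m e) <= esize e * X.
Proof.
move=> X0 mX.
(* All banks lie below level [L.+1], so [bits_eval] applies there with nothing of that level to
   bound. *)
have o0 : occ L.+1 e = 0.
  by elim: e => //= [b _ _|e1 -> e2 ->|e1 -> e2 ->] //; rewrite ltnS levL.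
have := @bits_eval m L.+1 X 0 e; rewrite o0; apply=> // b a lb.
by have := levL b; rewrite lb ltnn.
Qed.

(** There are at most [esize e] subexpressions, each charged at most [esize e * X] by
    [bits_eval_all]; hence the square. *)
Lemma ecost_leq m X e : 0 < X -> (forall b a, bits (m b a) <= X) ->
  ecost m e <= esize e * esize e * X.
Proof.
move=> X0 mX; elim: e => [c|b a IH|e1 IH1 e2 IH2|e1 IH1 e2 IH2|e1 IH1 e2 IH2].
- by have := bits_eval_all (EConst c) X0 mX; rewrite /= addn0; nia.
- have := mX b (eval m a); rewrite /=; nia.
- have := bits_eval_all (EAdd e1 e2) X0 mX; rewrite /=; nia.
- have := bits_eval_all (ESub e1 e2) X0 mX; rewrite /=; nia.
- have := bits_eval_all (EMul e1 e2) X0 mX; rewrite /=; nia.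
Qed.

Section Bounds.

Variable N : nat.
Hypothesis N0 : 0 < N.

Fixpoint bound (e : expr) : nat :=
  match e with
  | EConst c => c
  | ERead _ _ => N
  | EAdd e1 e2 => bound e1 + bound e2
  | ESub e1 _ => bound e1
  | EMul e1 e2 => bound e1 * bound e2
  end.

(** The 3 of a loop pays for its two initial writes and the final test, the 2 of an iteration for
    its test and the increment. *)
Fixpoint steps (s : stmt) : nat :=
  match s with
  | SSkip | SWrite _ _ _ => 1
  | SSeq s1 s2 | SIf _ s1 s2 => (steps s1 + steps s2).+1
  | SFor _ e s => 3 + bound e * (steps s + 2)
  end.

Variable T : nat.
Hypothesis T0 : 0 < T.

(* A write to a bank of level [j + 1] lengthens its numbers by at most [K] times
   the length of the numbers of level [j], and there are at most [T] writes. *)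
Fixpoint digits (j : nat) : nat :=
  if j is j'.+1 then N + T * K * digits j' else N.

(** State of the memory after at most [t] writes. The first two conditions serve the loop bounds,
    the third one the lengths of numbers. *)
Definition bounded (t : nat) (m : memory) :=
  [/\ m 0 0 <= N, m 0 1 <= N & forall b a,
      bits (m b a) <= if lev b is j.+1 then N + t * K * digits j else N].

Lemma leq_digits i j : i <= j -> digits i <= digits j.
Proof.
move/subnK <-; elim: (j - i) => //= d IH; apply: (leq_trans IH).
move: (digits _) => x; have : 0 < T * K by rewrite muln_gt0 T0 (leq_trans _ K10).
by nia.
Qed.

Lemma digits_gt0 j : 0 < digits j.
Proof. exact: leq_trans (leq_digits (leq0n j)). Qed.

Lemma bounded_bits t m b a : t <= T -> bounded t m -> bits (m b a) <= digits (lev b).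
Proof.
move=> tT [_ _ /(_ b a) h]; apply: leq_trans h _.
by case: (lev b) => //= j; rewrite leq_add2l !leq_mul.
Qed.

Lemma bounded_bits_all t m b a : t <= T -> bounded t m -> bits (m b a) <= digits L.
Proof. by move=> tT /(bounded_bits b a tT) h; apply: leq_trans h (leq_digits _). Qed.

Lemma bounded_ecost t m e : t <= T -> bounded t m -> esize e <= K ->
  ecost m e <= K * K * digits L.
Proof.
move=> tT mB eK; apply: leq_trans (ecost_leq e (digits_gt0 L) _) _.
  by move=> b a; apply: bounded_bits_all mB.
by rewrite !leq_mul.
Qed.

Lemma bounded_leq t t' m : t <= t' -> bounded t m -> bounded t' m.
Proof.
move=> tt' [m0 m1 mB]; split=> // b a; apply: leq_trans (mB b a) _.
by case: (lev b) => // j; rewrite leq_add2l !leq_mul.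
Qed.

Lemma bounded_upd t m b a e : t <= T -> bounded t m -> good_write b e ->
  bounded t.+1 (upd m b a (eval m e)).
Proof.
move=> tT mB /and3P[lb oe sK]; have [m0 m1 mA] := mB.
have b0 : (0 == b) = false by apply/eqP => b0; rewrite -b0 lev0 in lb.
split; rewrite /upd ?b0 // => c d; case: ifP => [/andP[/eqP-> _] | _]; last first.
  by have [_ _ ->] := bounded_leq (leqnSn t) mB.
case lbE : (lev b) lb oe => [//|j] _ oe.
have := @bits_eval m j.+1 (digits j) (N + t * K * digits j) e oe (digits_gt0 j).
have h1 : forall c d, lev c < j.+1 -> bits (m c d) <= digits j.
  move=> {}c {}d lc; apply: leq_trans (bounded_bits _ _ tT mB) _.
  exact: leq_digits.
have h2 : forall c d, lev c = j.+1 -> bits (m c d) <= N + t * K * digits j.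
  by move=> {}c {}d lc; have := mA c d; rewrite lc.
move=> /(_ h1 h2) h; apply: leq_trans h _.
have : esize e * digits j <= K * digits j by rewrite leq_mul.
by rewrite mulSn mulnDl; move: (K * _) (t * _ * _) => x y; nia.
Qed.

Lemma eval_bound t m e : bounded t m -> good_bound e -> eval m e <= bound e.
Proof.
case=> m0 m1 _; elim: e => //= [[|b] [[|[|c]] | | | | ] IH|e1 IH1 e2 IH2|e1 IH1 e2 IH2] //.
  by move=> /andP[/IH1 h1 /IH2 h2]; rewrite leq_add.
by move=> /andP[/IH1 h1 /IH2 h2]; rewrite leq_mul.
Qed.

(** Time and lengths are bounded in one induction: charges depend on lengths, and lengths on the
    number of writes so far. The limit [T] is fixed in advance so that the same [digits] serve
    throughout the run. *)
Lemma run_bounded s m t : good s -> bounded t m -> t + steps s <= T ->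
  exists c, [/\ run (compile s) m (sem s m) c,
                c <= steps s * (2 * (K * K * digits L)) &
                bounded (t + steps s) (sem s m)].
Proof.
set C := K * K * digits L.
have C0 : 0 < C.
  by rewrite /C !muln_gt0 digits_gt0; have -> : 0 < K by apply: leq_trans K10.
have eC t' m' e : t' <= T -> bounded t' m' -> esize e <= K -> ecost m' e <= C.
  exact: bounded_ecost.
have cK c : c <= 1 -> esize (EConst c) <= K by move=> c1; rewrite /=; lia.
elim: s m t => [|b a e|s1 IH1 s2 IH2|e s1 IH1 s2 IH2|b e s IH] m t /=.
- move=> _ mB tT; exists 1; split; [exact: RunSkip | lia |].
  by apply: bounded_leq mB; rewrite leq_addr.
- move=> /andP[aK gw] mB tT; have /and3P[_ _ eK] := gw.
  exists (ecost m a + ecost m e); split; first exact: RunWrite.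
    have tT' : t <= T by lia.
    by have := eC _ _ _ tT' mB aK; have := eC _ _ _ tT' mB eK; lia.
  by rewrite addn1; apply: bounded_upd => //; lia.
- move=> /andP[g1 g2] mB tT.
  have [|c1 [r1 h1 B1]] := IH1 _ _ g1 mB; first by lia.
  have [|c2 [r2 h2 B2]] := IH2 _ _ g2 B1; first by lia.
  exists (c1 + c2); split; first exact: RunSeq r1 r2.
    by move: h1 h2; clear; nia.
  by apply: bounded_leq B2; lia.
- move=> /and3P[eK g1 g2] mB tT.
  have tT' : t <= T by lia.
  have ce := eC _ _ _ tT' mB eK; case: ifPn => [ne|].
    have [|c1 [r1 h1 B1]] := IH1 _ _ g1 mB; first by lia.
    exists (ecost m e + c1); split; first exact: RunIfT.
      by move: h1 ce; clear; nia.
    by apply: bounded_leq B1; lia.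
  rewrite negbK => /eqP ne.
  have [|c2 [r2 h2 B2]] := IH2 _ _ g2 mB; first by lia.
  exists (ecost m e + c2); split; first exact: RunIfF.
    by move: h2 ce; clear; nia.
  by apply: bounded_leq B2; lia.
move=> /and4P[bs gw gb gs] mB tT; have /and3P[lb _ eK] := gw.
have le_n := eval_bound mB gb; set n := eval m e in le_n *.
set m1 := upd m b 1 n; set m2 := upd m1 b 0 0.
have tT' : t <= T by lia.
have B1 : bounded t.+1 m1 by apply: bounded_upd.
have gw0 : good_write b (EConst 0) by rewrite /good_write lb /=; lia.
have B2 : bounded t.+2 m2 by apply: (@bounded_upd _ _ _ _ (EConst 0)) => //; lia.
set test := ESub _ _; set next := EAdd _ _; set w := While _ _.
have gwn : good_write b next.
  by rewrite /good_write lb /= ltnn eqxx addn0 /=; lia.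
have testK : esize test <= K by rewrite /=; lia.
(* Generalised to [n'] remaining and [k] finished iterations, whose sum stays in register 1. *)
have gen n' m' t' k : m' b 0 = k -> m' b 1 = n' + k -> bounded t' m' ->
    t' + n' * (steps s + 2) <= T ->
    exists c, [/\ run w m' (loop (sem s) b n' k m') c,
      c <= (n' * (steps s + 2)).+1 * (2 * C) &
      bounded (t' + n' * (steps s + 2)) (loop (sem s) b n' k m')].
  elim: n' m' t' k => [|n' IHn] /= m' t1 k b0 b1 B1' tT1.
    exists (ecost m' test); split; last by rewrite addn0.
      by apply: RunWhileF; rewrite /= b0 b1 add0n subnn.
    by have tT2 : t1 <= T by [lia]; have := eC _ _ _ tT2 B1' testK; lia.
  have tT2 : t1 + steps s <= T by move: tT1; clear; nia.
  have [c1 [r1 h1 B2']] := IH _ _ gs B1' tT2.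
  have nextE : eval (sem s m') next = k.+1 by rewrite /= sem_frame // b0 addn1.
  have B3 : bounded (t1 + steps s).+1 (upd (sem s m') b 0 k.+1).
    by rewrite -nextE; apply: bounded_upd.
  have b0' : upd (sem s m') b 0 k.+1 b 0 = k.+1 by rewrite /upd !eqxx.
  have b1' : upd (sem s m') b 0 k.+1 b 1 = n' + k.+1.
    by rewrite /upd eqxx /= sem_frame // b1 addSnnS.
  have [|c2 [r2 h2 B4]] := IHn _ _ _ b0' b1' B3; first by move: tT1; clear; nia.
  exists (ecost m' test +
          (c1 + (ecost (sem s m') (EConst 0) + ecost (sem s m') next)) + c2).
  split.
  - apply: RunWhileT r2; first by rewrite /= b0 b1; lia.
    by apply: RunSeq r1 _; rewrite -nextE; apply: RunWrite.
  - have tT3 : t1 <= T by lia.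
    have := eC _ _ _ tT3 B1' testK; have := eC _ _ _ tT2 B2' (cK 0 isT).
    have : ecost (sem s m') next <= C by apply: (eC _ _ _ tT2 B2'); rewrite /=; lia.
    by move: h1 h2; clear; nia.
  - by apply: bounded_leq B4; clear; nia.
have hn := leq_mul le_n (leqnn (steps s + 2)).
have b1 : m2 b 1 = n + 0 by rewrite /m2 /m1 /upd !eqxx /= addn0.
have b0 : m2 b 0 = 0 by rewrite /m2 /m1 /upd !eqxx.
have [|c [r h B]] := gen n _ _ _ b0 b1 B2; first by lia.
exists (ecost m (EConst 1) + ecost m e +
        (ecost m1 (EConst 0) + ecost m1 (EConst 0) + c)); split.
- apply: RunSeq; first exact: RunWrite.
  by apply: RunSeq r; apply: RunWrite.
- have tT1 : t.+1 <= T by lia.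
  have := eC _ _ _ tT' mB eK; have := eC _ _ _ tT' mB (cK 1 isT).
  have := eC _ _ _ tT1 B1 (cK 0 isT).
  by move: h hn; clear; nia.
- by apply: bounded_leq B; move: hn; clear; lia.
Qed.

End Bounds.

Lemma polynomial_bound e : exists P : {poly nat}, forall N, (P.[N])%R = bound N e.
Proof.
elim: e => [c|b a _|e1 [P1 h1] e2 [P2 h2]|e1 [P1 h1] e2 _|e1 [P1 h1] e2 [P2 h2]].
- by exists (c%:P)%R => N; rewrite hornerC.
- by exists ('X)%R => N; rewrite hornerX.
- by exists (P1 + P2)%R => N; rewrite hornerD h1 h2.
- by exists P1.
- by exists (P1 * P2)%R => N; rewrite hornerM h1 h2.
Qed.

Lemma polynomial_steps s : exists P : {poly nat}, forall N, (P.[N])%R = steps N s.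
Proof.
elim: s => [|b a e|s1 [P1 h1] s2 [P2 h2]|e s1 [P1 h1] s2 [P2 h2]|b e s [P h]].
- by exists (1%N%:P)%R => N; rewrite hornerC.
- by exists (1%N%:P)%R => N; rewrite hornerC.
- exists (1%N%:P + (P1 + P2))%R => N; rewrite !hornerD hornerC h1 h2.
  exact: add1n.
- exists (1%N%:P + (P1 + P2))%R => N; rewrite !hornerD hornerC h1 h2.
  exact: add1n.
- have [Q hQ] := polynomial_bound e.
  exists (3%N%:P + Q * (P + 2%N%:P))%R => N.
  by rewrite !(hornerD, hornerM, hornerC) h hQ.
Qed.

(** Each level costs one more multiplication by [steps], so the degree grows with [j]; the number of
    levels is a constant of the program. *)
Lemma polynomial_digits s j :
  exists P : {poly nat}, forall N, (P.[N])%R = digits N (steps N s) j.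
Proof.
have [Q hQ] := polynomial_steps s.
elim: j => [|j [P h]]; first by exists ('X)%R => N; rewrite hornerX.
exists ('X + Q * K%:P * P)%R => N.
by rewrite !(hornerD, hornerM, hornerC, hornerX) h hQ.
Qed.

Lemma bits_leq_sumn (s : seq nat) x : x \in s -> bits x <= \sum_(y <- s) bits y.
Proof. by move=> xs; rewrite (big_rem _ xs) leq_addr. Qed.

(** Every entry of the encoding has at least one digit, and there are enough entries. This makes
    bounds in [nv] and [np] polynomial in the input size. *)
Lemma leq_input_size (I : instance) : nv I + np I <= input_size I.
Proof.
have : size (encode_instance I) <= input_size I.
  by rewrite -sum1_size; apply: leq_sum.
rewrite !size_cat (size_flatten_const (c := 3)); last first.
  by move=> _ /allpairsPdep[u [v [_ _ ->]]]; case: ifP.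
rewrite size_allpairs (size_flatten_const (c := 2)).
  2: by move=> _ /mapP[i _ ->].
rewrite !size_enum_ord (size_map _ (enum _)) size_enum_ord /=.
by case: (nv I) => [|n]; nia.
Qed.

Lemma bits_init_mem (I : instance) b a : bits (init_mem I b a) <= input_size I.
Proof.
have i0 : 0 < input_size I.
  by rewrite /input_size /encode_instance big_cons ltn_addr.
rewrite /init_mem; case: eqP => _; last by rewrite /bits trunc_log0.
have [lt_a|ge_a] := ltnP a (size (encode_instance I)); last first.
  by rewrite nth_default // /bits trunc_log0.
by apply: bits_leq_sumn; apply: mem_nth.
Qed.

Lemma polynomial_time_compile s : good s ->
  polynomial_time (compile s) /\
  forall I, exists t, run (compile s) (init_mem I) (sem s (init_mem I)) t.
Proof.
move=> gs.
have rn I : exists t, run (compile s) (init_mem I) (sem s (init_mem I)) t /\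
    t <= steps (input_size I) s *
      (2 * (K * K * digits (input_size I) (steps (input_size I) s) L)).
  set N := input_size I.
  have N0 : 0 < N by apply: leq_trans (bits_init_mem I 0 0).
  have T0 : 0 < steps N s by case: (s).
  have B0 : bounded N (steps N s) 0 (init_mem I).
    have := leq_input_size I; rewrite -/N => h; split=> [||b a].
    - by rewrite /init_mem /=; lia.
    - by rewrite /init_mem /=; lia.
    - by case: (lev b) => [|j]; rewrite ?mul0n ?addn0; apply: bits_init_mem.
  by have [|c [r h _]] := run_bounded N0 T0 gs B0; rewrite ?add0n //; exists c.
split=> [|I]; last by have [t [r _]] := rn I; exists t.
have [P hP] := polynomial_steps s; have [Q hQ] := polynomial_digits s L.
exists (P * (2%N%:P * (K%:P * K%:P * Q)))%R => I; have [t [r h]] := rn I.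
exists (sem s (init_mem I)), t; split=> //.
by rewrite !(hornerM, hornerC) hP hQ.
Qed.

End Cost.

(** * Walks and shortest paths *)

Section Walks.

Variables (V : eqType) (e : rel V) (W : V -> V -> nat).

Fixpoint walk_weight (x : V) (p : seq V) : nat :=
  if p is y :: q then W x y + walk_weight y q else 0.

Lemma walk_weight_cat x p q :
  walk_weight x (p ++ q) = walk_weight x p + walk_weight (last x p) q.
Proof. by elim: p x => //= y p IH x; rewrite IH addnA. Qed.

(** Cutting out cycles does not increase a natural weight. The final alternative is what later shows
    that greedy routes are simple. *)
Lemma shorten_walk x p : path e x p -> exists q,
  [/\ path e x q, last x q = last x p, uniq (x :: q), {subset q <= p} &
      walk_weight x q <= walk_weight x p /\ (q = p \/ size q < size p)].
Proof.
elim: p x => [|y p IH] x /=; first by exists [::]; split=> //; split=> //; left.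
move=> /andP[exy /IH[q [eq lq uq sq [wq zq]]]].
have [xq|xq] := boolP (x \in y :: q).
  have [q1 [q2 defq]] : exists q1 q2, y :: q = q1 ++ x :: q2.
    by case/splitPr: xq => q1 q2; exists q1, q2.
  have eyq : path e x (y :: q) by rewrite /= exy.
  have : uniq (y :: q) := uq.
  move: (eyq); rewrite defq cat_path cat_uniq /= => /and3P[_ _ e2] /and3P[_ _ u2].
  have lxq : last x (y :: q) = last x q2 by rewrite defq last_cat.
  have szq : size q2 < (size q).+1.
    by rewrite -[(size q).+1]/(size (y :: q)) defq size_cat /= addnS ltnS leq_addl.
  exists q2; split=> //.
  - by rewrite -lxq /= lq.
  - move=> z zq2; have : z \in y :: q by rewrite defq mem_cat inE zq2 !orbT.
    by rewrite !inE => /orP[->|/sq->]; rewrite ?orbT.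
  - split; last by right; case: zq => [<-//|zq]; lia.
    apply: leq_trans (leq_add (leqnn _) wq).
    rewrite -[W x y + _]/(walk_weight x (y :: q)) defq walk_weight_cat /=.
    by rewrite addnA leq_addl.
exists (y :: q); split=> //=.
- by rewrite exy.
- by rewrite xq.
- by move=> z; rewrite !inE => /orP[->|/sq->]; rewrite ?orbT.
- by split; [rewrite leq_add2l | case: zq => [->|zq]; [left | right]].
Qed.

(* [d j v] is one plus the least weight of a walk with [j] arcs from [s] to [v]
   that avoids [U], and [0] when there is none. *)
Record layered_distances (s : V) (U : pred V) (n : nat) (d : nat -> V -> nat) := {
  layer0 : forall v, d 0 v = ((v == s) && ~~ U v);
  layer_pred : forall j v, j < n -> 0 < d j.+1 v -> exists u,
    [/\ 0 < d j u, e u v, ~~ U v & d j.+1 v = d j u + W u v];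
  layer_min : forall j u v, j < n -> 0 < d j u -> e u v -> ~~ U v ->
    0 < d j.+1 v <= d j u + W u v }.

Section Layers.

Variables (s : V) (U : pred V) (n : nat) (d : nat -> V -> nat).
Hypothesis dP : layered_distances s U n d.

Lemma layer_le p : path e s p -> all (predC U) (s :: p) -> size p <= n ->
  0 < d (size p) (last s p) <= (walk_weight s p).+1.
Proof.
elim/last_ind: p => [|p v IH] /=.
  by rewrite (layer0 dP) eqxx /= andbT => _ ->.
rewrite rcons_path all_rcons size_rcons last_rcons -cats1 walk_weight_cat /= addn0.
move=> /andP[ep euv] /and3P[Us Uv Up] lt_n.
have /andP[d0 dle] : 0 < d (size p) (last s p) <= (walk_weight s p).+1.
  by apply: IH => //=; [rewrite Us | apply: ltnW].
have /andP[-> h] := layer_min dP lt_n d0 euv Uv.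
by apply: leq_trans h _; rewrite -addSn leq_add2r.
Qed.

Lemma layer_walk j v : j <= n -> 0 < d j v -> exists p,
  [/\ path e s p, last s p = v, size p = j, all (predC U) (s :: p) &
      d j v = (walk_weight s p).+1].
Proof.
elim: j v => [|j IH] v.
  move=> _; rewrite (layer0 dP); case: eqP => //= -> Us0; have Us : ~~ U s by case: (U s) Us0.
  by exists [::]; split=> //=; rewrite ?Us.
move=> jn /(layer_pred dP jn)[u [du euv Uv ->]].
have [p [ep lp zp Up ->]] := IH u (ltnW jn) du.
exists (rcons p v); split.
- by rewrite rcons_path ep lp.
- by rewrite last_rcons.
- by rewrite size_rcons zp.
- by move: Up => /= /andP[-> Up]; rewrite all_rcons /= Uv.
- by rewrite -cats1 walk_weight_cat /= lp addn0 addSn.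
Qed.

End Layers.

End Walks.

(** * Shortest paths in terms of integer weights *)

Section ShortestPaths.

Variables (I : instance) (D : nat) (W : 'I_(nv I) -> 'I_(nv I) -> nat).
Local Notation V := 'I_(nv I).
Hypothesis D0 : 0 < D.
Hypothesis WD : forall u v : V, (u, v) \in arcs I ->
  ((W u v)%:R = wt (u, v) * D%:R)%R.

Definition arc (u v : V) : bool := (u, v) \in arcs I.

Lemma path_length_walk x q : path arc x q ->
  (path_length (x :: q) * D%:R = (walk_weight W x q)%:R)%R.
Proof.
elim: q x => [|y q IH] x /=; first by rewrite /path_length big_nil mul0r.
move=> /andP[xy /IH h]; rewrite natrD WD // -h /path_length /= big_cons mulrDl.
by [].
Qed.

Lemma leq_path_length x y p q : path arc x p -> path arc y q ->
  (path_length (x :: p) <= path_length (y :: q))%R =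
  (walk_weight W x p <= walk_weight W y q).
Proof.
move=> ep eq; rewrite -(ler_nat rat) -!path_length_walk //.
by rewrite ler_pM2r // ltr0n.
Qed.

Lemma uniq_size (p : seq V) : uniq p -> size p <= nv I.
Proof. by move=> /card_uniqP <-; rewrite -[X in _ <= X]card_ord max_card. Qed.

(** Scaling by [D] preserves comparisons, and [shorten_walk] extends minimality from simple paths to
    all walks, which are what the layers compare. *)
Lemma shortest_pathP (s t : V) (p : seq V) :
  reflect (exists q, [/\ p = s :: q, path arc s q, last s q = t, uniq (s :: q) &
            forall q', path arc s q' -> last s q' = t ->
              walk_weight W s q <= walk_weight W s q'])
          (shortest_path s t p).
Proof.
apply: (iffP andP) => [[]|[q [-> eq lq uq minq]]].
  case: p => // x q /and4P[/eqP-> /eqP lq eq uq] /forallP minq.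
  exists q; split=> // r er lr.
  have [r' [er' lr' ur' _ [wr' _]]] := shorten_walk W er.
  apply: leq_trans wr'; rewrite -leq_path_length //.
  have /implyP := minq (Bseq (uniq_size ur')); apply.
  by apply/and4P; split=> //; rewrite lr' lr.
split; first by apply/and4P; split=> //; rewrite lq.
apply/forallP => r; apply/implyP; case: (bseqval r) => // x r'.
by move=> /and4P[/eqP-> /eqP lr er _]; rewrite leq_path_length // minq.
Qed.

End ShortestPaths.

(** * Counting *)

Section Counting.

Variables (V J : finType).

(** Double counting: after exchanging the sums, each element of [X] is counted for at most one
    [j]. *)
Lemma sum_disjoint_meet (A : {pred J}) (P : J -> {pred V}) (X : {pred V}) :
  {in A &, forall i j, i != j -> [disjoint P i & P j]} ->
  \sum_(j in A) #|[predI X & P j]| <= #|X|.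
Proof.
move=> dP; under eq_bigr do rewrite -sum1_card.
rewrite (exchange_big_dep (mem X)) /=; last by move=> j x _ /andP[].
rewrite -[leqRHS]sum1_card; apply: leq_sum => x xX.
have [j /andP[jA xj]|none] := pickP (fun j => (j \in A) && (x \in P j)); last first.
  rewrite big1 // => j /andP[jA /andP[_ xj]].
  by have /= := none j; rewrite jA xj.
rewrite (bigD1 j) /=; last by rewrite jA inE /= (xX : x \in X).
rewrite big1 // => i /andP[/andP[iA /andP[_ xi]] ij].
by have := disjointFr (dP _ _ iA jA ij) xi; rewrite [_ \in _]xj.
Qed.

End Counting.

(** Cauchy-Schwarz over the natural numbers, by summing [2 * (a * b) <= a ^ 2 + b ^ 2] over all
    pairs of indices. *)
Lemma sum_sqr_leq (I : finType) (A : {pred I}) (c : I -> nat) :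
  (\sum_(i in A) c i) ^ 2 <= #|A| * \sum_(i in A) c i ^ 2.
Proof.
rewrite -(leq_pmul2l (isT : 0 < 2)) -mulnn big_distrlr /= big_distrr /=.
under eq_bigr do rewrite big_distrr /=.
apply: (@leq_trans (\sum_(i in A) \sum_(j in A) (c i ^ 2 + c j ^ 2))).
  by apply: leq_sum => i _; apply: leq_sum => j _; rewrite nat_Cauchy.
under eq_bigr do rewrite big_split /= sum_nat_const.
by rewrite big_split /= sum_nat_const -big_distrr /= addnn mul2n.
Qed.

(** * The approximation bound for blocking solutions *)

Section Blocking.

Variable I : instance.
Implicit Types S T : solution I.

(* All that the analysis needs to know about the greedy algorithm. *)
Definition blocking S := forall j p, shortest_path (source j) (target j) p ->
  exists i q, [/\ S i = Some q, ~~ [disjoint p & q] & size q <= size p].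

Lemma feasibleP S : reflect
  ((forall i p, S i = Some p -> shortest_path (source i) (target i) p) /\
   (forall i j p q, i != j -> S i = Some p -> S j = Some q -> [disjoint p & q]))
  (feasible S).
Proof.
apply: (iffP andP) => [[/forallP h1 /forallP h2]|[h1 h2]].
  split=> [i p Si | i j p q ij Si Sj]; first by have := h1 i; rewrite Si.
  by have /forallP/(_ j)/implyP/(_ ij) := h2 i; rewrite Si Sj.
split; apply/forallP => i; first by case Si : (S i) => //; apply: h1.
apply/forallP => j; apply/implyP => ij.
by case Si : (S i) => [p|] //; case Sj : (S j) => [q|] //; apply: h2 ij Si Sj.
Qed.

Lemma shortest_path_uniq s t (p : seq 'I_(nv I)) :
  shortest_path s t p -> uniq p /\ 1 < size p + (s == t).
Proof.
case/andP; case: p => //= x q /and4P[/eqP-> /eqP<- _ ->] _; split=> //.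
by case: q => //=; rewrite ?eqxx //.
Qed.

Definition route S i : seq 'I_(nv I) := if S i is Some p then p else [::].

Lemma sum_size_route T : feasible T ->
  \sum_(j in [set j | T j != None]) size (route T j) = num_arcs T + value T.
Proof.
move=> /feasibleP[fT _]; rewrite /num_arcs /value -sum1_card.
rewrite [X in _ + X]big_mkcond [LHS]big_mkcond -big_split /=.
apply: eq_bigr => j _; rewrite inE /route; case Tj : (T j) => [p|] //=.
have [_] := shortest_path_uniq (fT _ _ Tj).
by rewrite (negPf (source_neq_target j)); case: (size p) => // m; rewrite addn1.
Qed.

Lemma vertices_leq T : feasible T -> num_arcs T + value T <= nv I.
Proof.
move=> fT; rewrite -sum_size_route //; have /feasibleP[pT dT] := fT.
rewrite -[leqRHS]card_ord.
have := @sum_disjoint_meet 'I_(nv I) _ [set j | T j != None]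
  (fun j => mem (route T j)) predT.
move=> /(_ _) h; apply: leq_trans (h _); last first.
  move=> i j; rewrite !inE /route.
  by case Ti : (T i) => [p|] //; case Tj : (T j) => [q|] // _ _ ij; apply: dT ij Ti Tj.
rewrite leq_eqVlt; apply/orP; left; apply/eqP/eq_bigr => j; rewrite inE /route.
case Tj : (T j) => [p|] // _; have [up _] := shortest_path_uniq (pT _ _ Tj).
by rewrite -(card_uniqP up); apply: eq_card => x; rewrite !inE.
Qed.

Lemma blocking_value S T : feasible S -> blocking S -> feasible T ->
  value T ^ 2 <= value S * (num_arcs T + value T).
Proof.
move=> fS bS fT; have /feasibleP[pT dT] := fT.
set A := [set j | T j != None]; set B := [set i | S i != None].
pose hits j i := [&& i \in B, ~~ [disjoint route T j & route S i] &
                    size (route S i) <= size (route T j)].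
(* [f] charges each pair of [T] to a pair of [S]; by [hitsf] the default value is never taken on
   [A]. *)
pose f j := odflt j [pick i | hits j i].
have hitsf j : j \in A -> hits j (f j).
  rewrite inE /f; case: pickP => //= none; case Tj : (T j) => [p|] // _.
  have [i [q [Si dq zq]]] := bS _ _ (pT _ _ Tj).
  by have := none i; rewrite /hits inE /route Si Tj dq zq.
pose c i := \sum_(j in A | f j == i) 1.
(* The paths charged to [i] are disjoint and each contains a vertex of [route S i]. *)
have c_le i : c i <= size (route S i).
  have := @sum_disjoint_meet 'I_(nv I) _ [pred j | (j \in A) && (f j == i)]
    (fun j => mem (route T j)) (mem (route S i)).
  move=> /(_ _) h; apply: leq_trans (leq_trans (h _) (card_size _)); last first.
    move=> j j'; rewrite !inE => /andP[+ _] /andP[+ _]; rewrite /route.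
    case Tj : (T j) => [p|] //; case Tj' : (T j') => [q|] // _ _ jj'.
    exact: dT jj' Tj Tj'.
  apply: leq_sum => j /andP[/hitsf/and3P[_ + _] /eqP <-].
  by rewrite disjoint_sym /disjoint /pred0b -lt0n.
have cA : \sum_(i in B) c i = value T.
  rewrite /value -sum1_card [RHS](partition_big f (mem B)) //= => j.
  by move=> /hitsf/and3P[].
have := sum_sqr_leq (mem B) c; rewrite cA => h; apply: leq_trans h _.
rewrite leq_mul2l; apply/orP; right; rewrite -sum_size_route //.
rewrite [leqRHS](partition_big f (mem B)) /=; last by move=> j /hitsf/and3P[].
(* Each of the [c i] paths charged to [i] has at least [size (route S i) >= c i] vertices, so
   together they have at least [c i ^ 2]. *)
apply: leq_sum => i _; rewrite -mulnn {1}/c big_distrl /=.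
apply: leq_sum => j /andP[/hitsf/and3P[_ _ zj] /eqP fj].
by rewrite mul1n; apply: leq_trans (c_le i) _; rewrite -fj.
Qed.

End Blocking.

(** * The program *)

(** Arrays indexed by arcs, by pairs of a number of arcs and a vertex, and by pairs
    of a terminal pair and a position are stored row by row, with rows of length
    [nv].  [Dist] and [Layer] contain lengths plus one, so that [0] stands for an
    infinite length; [Len] is the number of vertices of a route, [0] for a pair that
    is not selected.  Banks 11 to 17 belong to the loops. *)
Notation Out := 1 (only parsing).
Notation Weight := 2 (only parsing).
Notation Dist := 3 (only parsing).
Notation Layer := 4 (only parsing).
Notation Pred := 5 (only parsing).
Notation Used := 6 (only parsing).
Notation Len := 7 (only parsing).
Notation Route := 8 (only parsing).
Notation Cur := 9 (only parsing).
Notation Pos := 10 (only parsing).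

Definition reg (b : nat) : expr := ERead b (EConst 0).

Notation nE := (ERead 0 (EConst 0)).
Notation npE := (ERead 0 (EConst 1)).
Notation eE := (reg 11).
Notation fE := (reg 12).
Notation kE := (reg 13).
Notation iE := (reg 14).
Notation jE := (reg 15).
Notation vE := (reg 16).
Notation uE := (reg 17).

Definition cellE (a b : expr) : expr := EAdd (EMul a nE) b.
(** Registers 0 and 1 hold [nv] and [np], so the fields of an arc are numbered from 2: presence,
    numerator, denominator. In [endE], likewise, 2 is the source and 3 the target. *)
Definition fieldE (c : nat) (e : expr) : expr :=
  ERead 0 (EAdd (EMul e (EConst 3)) (EConst c)).
Definition endE (c : nat) (i : expr) : expr :=
  ERead 0 (EAdd (EMul (EMul nE nE) (EConst 3)) (EAdd (EMul i (EConst 2)) (EConst c))).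
Definition arcE u v := fieldE 2 (cellE u v).
Definition sourceE i := endE 2 i.
Definition targetE i := endE 3 i.
Definition notE (a : expr) : expr := ESub (EConst 1) a.
Definition neqE (a b : expr) : expr := EAdd (ESub a b) (ESub b a).
Definition eqE (a b : expr) : expr := notE (neqE a b).

(** Multiplying each numerator by the denominators of all other arcs scales all lengths by the same
    factor without any division. *)
Definition weights_prog : stmt :=
  SFor 11 (EMul nE nE) (SSeq
    (SWrite Weight eE (fieldE 3 eE))
    (SFor 12 (EMul nE nE)
      (SIf (EMul (fieldE 2 fE) (neqE eE fE))
        (SWrite Weight eE (EMul (ERead Weight eE) (fieldE 4 fE)))
        SSkip))).

Definition nextcellE := cellE (EAdd jE (EConst 1)) vE.
Definition nextE := ERead Layer nextcellE.
Definition candE := EAdd (ERead Layer (cellE jE uE)) (ERead Weight (cellE uE vE)).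

Definition relaxE :=
  EMul (EMul (arcE uE vE) (notE (ERead Used vE)))
       (EMul (ERead Layer (cellE jE uE)) (EAdd (notE nextE) (ESub nextE candE))).

Definition relax_prog : stmt := SSeq
  (SWrite Layer nextcellE (EConst 0))
  (SFor 17 nE
    (SIf relaxE
      (SSeq (SWrite Layer nextcellE candE)
            (SWrite Pred nextcellE uE))
      SSkip)).

Definition layers_prog : stmt := SSeq
  (SFor 16 nE (SWrite Layer vE
     (EMul (eqE vE (sourceE iE)) (notE (ERead Used vE)))))
  (SFor 15 nE (SFor 16 nE relax_prog)).

Definition layerE := ERead Layer (cellE jE (targetE iE)).

Definition dist_prog : stmt := SSeq (SWrite Dist iE (EConst 0))
  (SFor 15 nE
    (SIf (EMul layerE (EAdd (notE (ERead Dist iE)) (ESub (ERead Dist iE) layerE)))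
      (SWrite Dist iE layerE) SSkip)).

(** Run while no vertex is used, so [Dist] refers to the whole graph, whereas later layers avoid the
    used vertices. *)
Definition distances_prog : stmt := SFor 14 npE (SSeq layers_prog dist_prog).

(** Positions [k] down to 1 are filled backwards along [Pred]. As [good_bound] does not admit the
    bound [kE], the loop makes [nE] rounds and idles after the first [k]. *)
Definition trace_prog : stmt :=
  SFor 15 nE
    (SIf (ESub kE jE)
      (SSeq (SWrite Route (cellE iE (ESub kE jE)) (reg Cur))
      (SSeq (SWrite Used (reg Cur) (EConst 1))
            (SWrite Cur (EConst 0) (ERead Pred (cellE (ESub kE jE) (reg Cur))))))
      SSkip).

Definition route_prog : stmt := SSeq
  (SSeq (SWrite Len iE (EAdd kE (EConst 1))) (SWrite Cur (EConst 0) (targetE iE)))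
  (SSeq trace_prog
  (SSeq (SWrite Route (cellE iE (EConst 0)) (sourceE iE))
        (SWrite Used (sourceE iE) (EConst 1)))).

Definition topE := ERead Layer (cellE kE (targetE iE)).

Definition try_prog : stmt :=
  SIf (ERead Len iE) SSkip
    (SSeq layers_prog
      (SIf (EMul topE (eqE topE (ERead Dist iE))) route_prog SSkip)).

Definition greedy_prog : stmt := SFor 13 nE (SFor 14 npE try_prog).

Definition emit (e : expr) : stmt := SSeq
  (SWrite Out (reg Pos) e) (SWrite Pos (EConst 0) (EAdd (reg Pos) (EConst 1))).

Definition output_prog : stmt :=
  SFor 14 npE (SSeq (emit (ERead Len iE))
    (SFor 15 nE
      (SIf (ESub (ERead Len iE) jE) (emit (ERead Route (cellE iE jE))) SSkip))).

Definition algorithm : stmt :=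
  SSeq weights_prog (SSeq distances_prog (SSeq greedy_prog output_prog)).

(** The levels follow the flow of data: [Weight], then [Layer] and [Pred], then [Dist] and [Cur],
    then [Route], then [Out]. [Pos] and the loop banks have the default level 1. *)
Definition level (b : nat) : nat :=
  nth 1 [:: 0; 5; 1; 3; 2; 2; 1; 2; 4; 3] b.

Lemma good_algorithm : good level 200 algorithm.
Proof. by vm_compute. Qed.

Lemma level_leq b : level b <= 5.
Proof. by do 10 case: b => // b; rewrite /level nth_default. Qed.

Lemma cell_eq n j v j' v' : v < n -> v' < n ->
  (j * n + v == j' * n + v') = (j == j') && (v == v').
Proof.
move=> vn vn'; have n0 : 0 < n by apply: leq_ltn_trans vn.
apply/eqP/andP => [h|[/eqP-> /eqP->]] //.
have := congr1 (divn^~ n) h; have := congr1 (modn^~ n) h.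
by rewrite !modnMDl !divnMDl // !divn_small // !modn_small // !addn0 => -> ->.
Qed.

Lemma leq_cell n u v : u < n -> v < n -> u * n + v < n * n.
Proof. by nia. Qed.

(** * Layout of the input in memory *)

Section Input.

Variable I : instance.
Local Notation V := 'I_(nv I).
Local Notation n := (nv I).

Lemma input_nv : init_mem I 0 0 = nv I. Proof. by []. Qed.

Definition arc_entry (u v : V) : seq nat :=
  if (u, v) \in arcs I
  then [:: 1; `|numq (wt (u, v))|; `|denq (wt (u, v))|] else [:: 0; 0; 0].

Definition arc_entries : seq (seq nat) :=
  flatten [seq [seq arc_entry u v | v <- enum V] | u <- enum V].

Definition pair_entries : seq (seq nat) :=
  [seq [:: val (source i); val (target i)] | i <- enum 'I_(np I)].

Lemma init_memE a :
  init_mem I 0 a.+2 = nth 0 (flatten arc_entries ++ flatten pair_entries) a.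
Proof. by []. Qed.

Lemma arc_rowE l : l \in [seq [seq arc_entry u v | v <- enum V] | u <- enum V] ->
  size l = n.
Proof. by case/mapP => u _ ->; rewrite size_map size_enum_ord. Qed.

Lemma size_arc_entries : size arc_entries = n * n.
Proof.
by rewrite (size_flatten_const arc_rowE) (size_map _ (enum _)) size_enum_ord.
Qed.

Lemma arc_entriesE l : l \in arc_entries -> size l = 3.
Proof.
by case/flatten_mapP => u _ /mapP[v _ ->]; rewrite /arc_entry; case: ifP.
Qed.

Lemma input_field (u v : V) k : k < 3 ->
  init_mem I 0 ((u * n + v) * 3 + k.+2) = nth 0 (arc_entry u v) k.
Proof.
move=> k3; rewrite !addnS init_memE nth_cat.
rewrite (size_flatten_const arc_entriesE) size_arc_entries.
have uv := leq_cell (ltn_ord u) (ltn_ord v).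
rewrite ifT; last by move: (u * n + v) uv => c; lia.
rewrite (nth_flatten_const _ arc_entriesE) ?size_arc_entries //; congr nth.
rewrite /arc_entries (nth_flatten_const _ arc_rowE) //.
- by rewrite (nth_map u) ?size_enum_ord // (nth_map v) ?size_enum_ord // !nth_ord_enum.
- by rewrite (size_map _ (enum _)) size_enum_ord.
Qed.

Lemma input_end (i : 'I_(np I)) k : k < 2 ->
  init_mem I 0 (n * n * 3 + (i * 2 + k.+2)) =
  nth 0 [:: val (source i); val (target i)] k.
Proof.
move=> k2; rewrite !addnS init_memE nth_cat.
rewrite (size_flatten_const arc_entriesE) size_arc_entries ltnNge leq_addr /= addKn.
rewrite (@nth_flatten_const _ _ _ 2) //.
- by rewrite (nth_map i) ?size_enum_ord // nth_ord_enum.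
- by move=> l /mapP[x _ ->].
- by rewrite (size_map _ (enum _)) size_enum_ord.
Qed.

End Input.

Lemma neq_test a b : (a - b + (b - a) != 0) = (a != b).
Proof. by rewrite addn_eq0 !subn_eq0 eqn_leq. Qed.

(** * Integer weights with a common denominator *)

Section Weights.

Variable I : instance.
Local Notation V := 'I_(nv I).
Local Notation n := (nv I).

Definition is_arc c := init_mem I 0 (c * 3 + 2).
Definition num c := init_mem I 0 (c * 3 + 3).
Definition den c := init_mem I 0 (c * 3 + 4).

(** Truncated at [k] to follow the inner loop; for an arc [c] and [k = n * n] it is [common_den]
    without the factor of [c]. *)
Definition cofactor k c : nat :=
  \prod_(0 <= f < k) if (is_arc f != 0) && (f != c) then den f else 1.

Definition common_den : nat :=
  \prod_(0 <= f < n * n) if is_arc f != 0 then den f else 1.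

Definition weight (u v : V) : nat :=
  num (u * n + v) * cofactor (n * n) (u * n + v).

Lemma is_arcE (u v : V) : (is_arc (u * n + v) != 0) = arc u v.
Proof.
by rewrite /is_arc (@input_field _ _ _ 0) // /arc_entry /arc; case: ifP.
Qed.

Lemma denE (u v : V) : arc u v -> den (u * n + v) = `|denq (wt (u, v))|.
Proof. by rewrite /den (@input_field _ _ _ 2) // /arc_entry /arc => ->. Qed.

Lemma numE (u v : V) : arc u v -> num (u * n + v) = `|numq (wt (u, v))|.
Proof. by rewrite /num (@input_field _ _ _ 1) // /arc_entry /arc => ->. Qed.

Lemma cell_surj c : c < n * n -> exists u v : V, c = u * n + v.
Proof.
move=> cn; have n0 : 0 < n by case: (n) cn.
have un : c %/ n < n by rewrite ltn_divLR.
have vn : c %% n < n by rewrite ltn_mod.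
by exists (Ordinal un), (Ordinal vn); rewrite /= -divn_eq.
Qed.

Lemma common_den_gt0 : 0 < common_den.
Proof.
rewrite /common_den big_nat prodn_cond_gt0 // => f /andP[_ /cell_surj[u [v ->]]].
by rewrite is_arcE; case: ifP => // /denE ->; rewrite absz_gt0 denq_neq0.
Qed.

Lemma weightE (u v : V) : (u, v) \in arcs I ->
  ((weight u v)%:R = wt (u, v) * common_den%:R :> rat)%R.
Proof.
move=> uv; rewrite /weight /cofactor /common_den.
set c := u * n + v; have cn : c < n * n by apply: leq_cell.
have cI : c \in index_iota 0 (n * n) by rewrite mem_index_iota.
rewrite [in RHS](bigD1_seq c) ?iota_uniq //= is_arcE /arc uv.
rewrite (bigD1_seq c) ?iota_uniq //= eqxx andbF mul1n.
rewrite (eq_bigr (fun f => if is_arc f != 0 then den f else 1)); last first.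
  by move=> f ->; rewrite andbT.
rewrite !natrM mulrA; congr (_ * _)%R.
rewrite numE // denE // !natr_absz.
rewrite ger0_norm ?numq_ge0 ?wt_ge0 // gtr0_norm ?denq_gt0 //.
by rewrite numqE.
Qed.

Lemma weights_spec m : (forall a, m 0 a = init_mem I 0 a) ->
  forall u v : V, sem weights_prog m Weight (u * n + v) = weight u v.
Proof.
move=> inp u v; have cn := leq_cell (ltn_ord u) (ltn_ord v); rewrite /weight.
move: (u * n + v) cn => c cn.
pose P k (m' : memory) := forall d, d < k -> m' Weight d = num d * cofactor (n * n) d.
suff : P (n * n) (sem weights_prog m) by apply.
have nnE m' : (forall a, m' 0 a = m 0 a) -> eval m' (EMul nE nE) = n * n.
  by move=> h /=; rewrite !h inp.
rewrite -[X in P X _](nnE m) //; apply: sem_for => // k m' _ mk fr Pk.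
have inp' a : m' 0 a = init_mem I 0 a by rewrite fr // inp.
move=> d; rewrite upd_other // => dk.
set body := SIf _ _ _; set m1 := upd m' Weight (eval m' eE) (eval m' (fieldE 3 eE)).
pose Q l (m2 : memory) :=
  m2 Weight k = num k * cofactor l k /\ forall d, d < k -> m2 Weight d = m' Weight d.
have [] : Q (n * n) (sem (SFor 12 (EMul nE nE) body) m1).
  rewrite -[X in Q X _](nnE m1); last first.
    by move=> a; rewrite /m1 upd_other // inp' inp.
  apply: sem_for => //.
    rewrite /Q /m1 /upd /= mk eqxx /cofactor big_geq // muln1 inp'.
    by split=> // d' d'k; rewrite ifN // neq_ltn d'k.
  move=> l m2 _ ml fr2 [Qk Qd].
  have m2k : m2 11 0 = k by rewrite fr2 // /m1 upd_other.
  have inp2 a : m2 0 a = init_mem I 0 a by rewrite fr2 // /m1 upd_other.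
  rewrite /Q /body /= ml m2k inp2 /cofactor big_nat_recr //= -/(cofactor l k).
  have -> : (init_mem I 0 (l * 3 + 2) * (k - l + (l - k)) != 0) =
            (is_arc l != 0) && (l != k).
    by rewrite muln_eq0 negb_or neq_test [k == l]eq_sym.
  case: ifP => _; last by rewrite muln1; split=> [|d' d'k]; rewrite upd_other ?Qk ?Qd.
  split=> [|d' d'k]; rewrite upd_other // /upd /=.
    by rewrite ?m2k ?ml eqxx Qk ?inp2 mulnA.
  by rewrite ?m2k ifN ?Qd // neq_ltn d'k.
move=> Qk Qd; move: dk; rewrite ltnS leq_eqVlt => /orP[/eqP->|dk]; first exact: Qk.
by rewrite -(Pk d dk); apply: Qd.
Qed.

End Weights.

(** * Layered distances *)

Section Layers.

Variable I : instance.
Local Notation V := 'I_(nv I).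
Local Notation n := (nv I).

Definition ready (m : memory) : Prop :=
  (forall a, m 0 a = init_mem I 0 a) /\
  (forall u v : V, m Weight (u * n + v) = weight u v).

Lemma ready_frame m m' : ready m ->
  (forall c a, c <= 2 -> c != 1 -> m' c a = m c a) -> ready m'.
Proof. by case=> h1 h2 fr; split=> [a|u v]; rewrite fr. Qed.

Definition used (m : memory) : pred V := fun v => m Used v != 0.

Definition dist_layer (m : memory) (j : nat) (v : V) : nat := m Layer (j * n + v).

(** Recurrence for the cell of [v] in row [j.+1], with value [d] and predecessor [p]: the first half
    says that [p] attains [d], the second that [d] is minimal. *)
Definition cell_ok (m : memory) j (v : V) (d : nat) (p : nat) : Prop :=
  (0 < d -> exists u : V, [/\ p = u, 0 < dist_layer m j u, arc u v, ~~ used m v &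
      d = dist_layer m j u + weight u v]) /\
  (forall u : V, 0 < dist_layer m j u -> arc u v -> ~~ used m v ->
      0 < d <= dist_layer m j u + weight u v).

Lemma eval_arc m (u v : V) : ready m ->
  m 0 ((u * n + v) * 3 + 2) = arc u v.
Proof.
by case=> inp _; rewrite inp (@input_field _ _ _ 0) // /arc_entry /arc; case: ifP.
Qed.

Lemma relax_test (a b : bool) x y z :
  (a * (1 - b) * (x * (1 - y + (y - z))) != 0) =
  [&& a, ~~ b, 0 < x & (y == 0) || (z < y)].
Proof. by case: a; case: b; rewrite ?mul0n // ?mul1n /= muln_eq0 addn_eq0; lia. Qed.

Lemma relax_spec m j (v : V) (c := j.+1 * n + v) (m' := sem relax_prog m) :
  ready m -> m 15 0 = j -> m 16 0 = v ->
  [/\ forall a, a != c -> m' Layer a = m Layer a,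
      forall a, a != c -> m' Pred a = m Pred a &
      cell_ok m j v (m' Layer c) (m' Pred c)].
Proof.
move=> rm mj mv; rewrite /m' /relax_prog sem_seq.
set loop_body := SIf _ _ _.
have cellc : eval m nextcellE = c.
  by rewrite /= mj mv rm.1 input_nv addn1.
have -> : sem (SWrite Layer nextcellE (EConst 0)) m = upd m Layer c 0 by rewrite -cellc.
set m1 := upd m Layer c 0.
have m1E b a : b != Layer -> m1 b a = m b a by move=> b4; rewrite /m1 upd_other.
have rm1 : ready m1 by apply: ready_frame rm _ => b a b2 _; rewrite m1E //; lia.
have n1 : eval m1 nE = n by rewrite /= m1E // rm.1.
have prev (u : V) : (j * n + u == c) = false.
  by rewrite /c cell_eq // -{1}[j]addn0 -addn1 eqn_add2l.
pose P k (m2 : memory) :=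
  [/\ forall a, a != c -> m2 Layer a = m Layer a,
      forall a, a != c -> m2 Pred a = m Pred a,
      0 < m2 Layer c -> exists u : V, [/\ m2 Pred c = u, 0 < dist_layer m j u,
        arc u v, ~~ used m v & m2 Layer c = dist_layer m j u + weight u v] &
      forall u : V, u < k -> 0 < dist_layer m j u -> arc u v -> ~~ used m v ->
        0 < m2 Layer c <= dist_layer m j u + weight u v].
suff : P n (sem (SFor 17 nE loop_body) m1).
  by case=> h1 h2 h3 h4; split=> //; split=> // u; apply: h4.
rewrite -[X in P X _]n1; apply: sem_for => [//||].
  rewrite /P /m1 /upd /= eqxx; split=> // a ac.
  by rewrite (negPf ac).
move=> k m2; rewrite n1 => kn mk fr [h1 h2 h3 h4].
have fr' b a : b \notin [:: 17; Layer; Pred] -> m2 b a = m b a.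
  rewrite !inE !negb_or => /and3P[b17 b4 b5].
  by rewrite fr ?m1E // in_cons /= !inE !negb_or b17 b4 b5.
have cellc2 : eval m2 nextcellE = c.
  by rewrite /= !fr' // mj mv rm.1 input_nv addn1.
pose w := Ordinal kn.
have prevE : m2 Layer (j * n + k) = dist_layer m j w.
  by rewrite h1 // (prev w).
have candV : eval m2 candE = dist_layer m j w + weight w v.
  by rewrite /= mk (fr' 15) // (fr' 0) // (fr' 16) // (fr' Weight) // mj mv rm.1
    input_nv prevE -(rm.2 w v).
have testE : (eval m2 relaxE != 0) = [&& arc w v, ~~ used m v,
    0 < dist_layer m j w &
    (m2 Layer c == 0) || (dist_layer m j w + weight w v < m2 Layer c)].
  have -> : eval m2 relaxE = arc w v * (1 - m Used v) *
      (dist_layer m j w * (1 - m2 Layer c +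
        (m2 Layer c - (dist_layer m j w + weight w v)))).
    rewrite -candV -prevE -cellc2 /relaxE /nextE /= mk !(fr' 0) // !(fr' 15) // !(fr' 16) //.
    rewrite (fr' Used) // mj mv (rm.1 0) input_nv; congr (_ * _ * _).
    by rewrite -(eval_arc w v rm).
  have -> : 1 - m Used v = 1 - used m v by rewrite /used; case: (m Used v).
  exact: relax_test.
rewrite /loop_body sem_if testE; case: ifPn.
  move=> /and4P[a_wv Uv d0 lt_d].
  have -> : sem (SSeq (SWrite Layer nextcellE candE) (SWrite Pred nextcellE uE)) m2 =
      upd (upd m2 Layer c (eval m2 candE)) Pred c (m2 17 0) by rewrite -cellc2.
  rewrite candV mk; split=> [a ac|a ac|_|u].
  - by rewrite /upd /= (negPf ac) h1.
  - by rewrite /upd /= (negPf ac) h2.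
  - by exists w; rewrite /upd /= eqxx; split.
  - rewrite /upd /= eqxx ltnS leq_eqVlt => /orP[/eqP uk|uk] du au Uu.
      by have -> : u = w by [exact: val_inj]; rewrite addn_gt0 d0 leqnn.
    have /andP[x0 xle] := h4 u uk du au Uu.
    by rewrite addn_gt0 d0 /=; move: lt_d; rewrite eqn0Ngt x0 /=; lia.
move=> none; split=> [a ac|a ac||u]; rewrite /upd /=.
- exact: h1.
- exact: h2.
- exact: h3.
- rewrite ltnS leq_eqVlt => /orP[/eqP uk|uk] du au Uu; last exact: h4.
  have uw : u = w by exact: val_inj.
  by move: none; rewrite -uw du au Uu /=; lia.
Qed.

Definition step_ok (m : memory) j (v : V) : Prop :=
  cell_ok m j v (dist_layer m j.+1 v) (m Pred (j.+1 * n + v)).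

Lemma cell_ok_ext (m m' : memory) j v d p : (forall u : V, m' Used u = m Used u) ->
  (forall u, dist_layer m' j u = dist_layer m j u) ->
  cell_ok m j v d p -> cell_ok m' j v d p.
Proof.
move=> eU ed [h1 h2]; have eU' u : used m' u = used m u by rewrite /used eU.
split=> [/h1[u]|u]; first by exists u; rewrite eU' ed.
by rewrite eU' ed; apply: h2.
Qed.

Lemma layers_spec m (i : 'I_(np I)) (m' := sem layers_prog m) :
  ready m -> m 14 0 = i ->
  (forall v, dist_layer m' 0 v = (v == source i) && ~~ used m v) /\
  (forall j v, j < n -> step_ok m' j v).
Proof.
move=> rm mi; rewrite /m' /layers_prog sem_seq.
set m1 := sem (SFor 16 _ _) m; set body := SFor 16 nE relax_prog.
have nm : eval m nE = n by rewrite /= rm.1.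
have fr1 b a : b != 16 -> b != Layer -> m1 b a = m b a.
  by move=> b16 b4; rewrite /m1 sem_frame // !inE negb_or b16.
have row0 (v : V) : m1 Layer v = (v == source i) && ~~ used m v.
  pose P k (m2 : memory) := forall v : V, v < k ->
    m2 Layer v = (v == source i) && ~~ used m v.
  suff : P n m1 by apply; apply: ltn_ord.
  rewrite -[X in P X _]nm; apply: sem_for => [//|//|k m2]; rewrite nm => kn mk fr Pk u.
  rewrite upd_other //= mk /upd /= ltnS leq_eqVlt => /orP[/eqP uk|uk].
    2: by rewrite ltn_eqF // Pk.
  rewrite uk eqxx !(fr 0) // (fr 14) // (fr Used) // mi !rm.1 input_nv.
  rewrite (@input_end _ _ 0) //= -uk -(inj_eq val_inj) /used /=.
  by case: eqVneq => [->|]; case: (m Used u) => [|x]; lia.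
(* One invariant, counting finished cells in row-major order, serves both nested loops. *)
pose P k (m2 : memory) := (forall v, dist_layer m2 0 v = (v == source i) && ~~ used m v)
  /\ forall j (v : V), j * n + v < k -> step_ok m2 j v.
suff [h1 h2] : P (n * n) (sem (SFor 15 nE body) m1).
  by split=> // j v jn; apply: h2; apply: leq_cell.
have n1 : eval m1 nE = n by rewrite /= fr1 // rm.1.
pose P' k := P (k * n).
rewrite -/(P' n) -[X in P' X _]n1; apply: sem_for => [//||].
  by split=> [v|j v] //; rewrite -row0 /dist_layer mul0n add0n /upd.
move=> k m2; rewrite n1 => kn mk fr Pk; rewrite /P' mulSn addnC.
have fr2 b a : b \notin [:: 15; 16; 17; Layer; Pred] -> m2 b a = m b a.
  rewrite !inE !negb_or => /and5P[b15 b16 b17 b4 b5].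
  by rewrite fr ?fr1 // /body /= !inE !negb_or b15 b16 b17 b4 b5.
pose Q l := P (k * n + l).
have n2 : eval m2 nE = n by rewrite /= fr2 // rm.1.
suff : Q n (sem body m2).
  by case=> h1 h2; split=> [v|j v jv]; [rewrite -h1 | have := h2 j v jv].
rewrite -[X in Q X _]n2; apply: sem_for => [//||].
  rewrite /Q addn0; case: Pk => h1 h2.
  by split=> [v|j v jv]; [rewrite -h1 | have := h2 j v jv].
move=> l m3; rewrite n2 => ln ml fr' [h1 h2].
have fr3 b a : b \notin [:: 15; 16; 17; Layer; Pred] -> m3 b a = m b a.
  move=> hb; rewrite fr' ?fr2 //; move: hb; rewrite !inE !negb_or => /and5P[b15 b16 b17 b4 b5].
  by rewrite b16 b17 b4 b5.
pose v := Ordinal ln.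
have rm3 : ready m3.
  apply: ready_frame rm _ => b a b2 _; apply: fr3; rewrite !inE; lia.
have m3k : m3 15 0 = k by rewrite fr' // /upd.
have [e1 e2 e3] := @relax_spec m3 k v rm3 m3k ml.
(* The cell being written is involved in none of the recurrences already established. *)
have c_ok j (w u : V) : j * n + w < k * n + l ->
  (j * n + u != k.+1 * n + v) /\ (j.+1 * n + w != k.+1 * n + v).
  move=> jw; have jk : j <= k.
    rewrite leqNgt; apply/negP => kj; have := leq_mul kj (leqnn n).
    by rewrite mulSn; lia.
  rewrite !cell_eq //; split; apply/negP => /andP[/eqP jE /eqP wE]; first by lia.
  by case: jE => jE; move: jw; rewrite jE ltn_add2l wE ltnn.
have used3 u : used m3 u = used m u by rewrite /used fr3.
split=> [u|j w].
  rewrite /dist_layer upd_other // e1; first exact: h1.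
  by rewrite cell_eq.
rewrite addnS ltnS leq_eqVlt => /orP[/eqP|jw].
  move=> /eqP; rewrite (cell_eq _ _ (ltn_ord w) (ltn_ord v)) => /andP[/eqP-> /eqP wv].
  have -> : w = v by exact: val_inj.
  rewrite /step_ok /dist_layer !upd_other //.
  apply: (@cell_ok_ext m3) e3 => [u|u]; rewrite /dist_layer upd_other //.
    by rewrite sem_frame.
  rewrite e1 // cell_eq //.
  by rewrite -{1}[k]addn0 -addn1 eqn_add2l.
have := h2 _ _ jw; rewrite /step_ok /dist_layer !upd_other // e1 ?e2 //;
  do ?by case: (c_ok _ _ w jw).
apply: cell_ok_ext => u; first by rewrite upd_other // sem_frame.
by rewrite /dist_layer upd_other // e1 //; case: (c_ok _ _ u jw).
Qed.

End Layers.

(** * Distances in the whole graph *)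

Section Distances.

Variable I : instance.
Local Notation V := 'I_(nv I).
Local Notation n := (nv I).
Local Notation weight := (@weight I).
Local Notation arc := (@arc I).

Lemma layers_distances m (i : 'I_(np I)) : ready I m -> m 14 0 = i ->
  layered_distances arc weight (source i) (used m) n
    (@dist_layer I (sem layers_prog m)).
Proof.
move=> rm mi; have [h0 hS] := layers_spec rm mi.
have usedE (v : V) : used (sem layers_prog m) v = used m v.
  by rewrite /used sem_frame.
split=> [//|j v jn d0|j u v jn d0 auv Uv].
  have [[//|u [_ du auv Uv ->]] _] := hS j v jn.
  by exists u; rewrite -usedE.
by have [_ /(_ u)] := hS j v jn; rewrite usedE; apply.
Qed.

Definition dist_ok (i : 'I_(np I)) d :=
  (0 < d -> exists p, [/\ path arc (source i) p, last (source i) p = target i &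
      d = (walk_weight weight (source i) p).+1]) /\
  (forall p, path arc (source i) p -> last (source i) p = target i ->
    0 < d <= (walk_weight weight (source i) p).+1).

Lemma target_spec m (i : 'I_(np I)) : (forall a, m 0 a = init_mem I 0 a) ->
  m 14 0 = i -> eval m (targetE iE) = target i.
Proof. by move=> rm mi; rewrite /= mi !rm input_nv (@input_end _ _ 1). Qed.

Lemma dist_spec m (i : 'I_(np I)) (m' := sem dist_prog m) :
  ready I m -> m 14 0 = i ->
  [/\ forall a : nat, a != i -> m' Dist a = m Dist a,
      0 < m' Dist i -> exists2 j, j < n & m' Dist i = dist_layer m j (target i) &
      forall j, j < n -> 0 < dist_layer m j (target i) ->
        0 < m' Dist i <= dist_layer m j (target i)].
Proof.
move=> rm mi; rewrite /m' /dist_prog sem_seq.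
have -> : sem (SWrite Dist iE (EConst 0)) m = upd m Dist i 0 by rewrite -mi.
set m1 := upd _ _ _ _; set body := SIf _ _ _.
pose P k (m2 : memory) := [/\ forall a : nat, a != i -> m2 Dist a = m Dist a,
      0 < m2 Dist i -> exists2 j, j < k & m2 Dist i = dist_layer m j (target i) &
      forall j, j < k -> 0 < dist_layer m j (target i) ->
        0 < m2 Dist i <= dist_layer m j (target i)].
suff : P n (sem (SFor 15 nE body) m1) by [].
have n1 : eval m1 nE = n by rewrite /= /m1 upd_other // rm.1.
rewrite -[X in P X _]n1; apply: sem_for => [//||].
  rewrite /P /m1 /upd /= eqxx; split=> // a ai; by rewrite (negPf ai).
move=> k m2; rewrite n1 => kn mk fr [h1 h2 h3].
have fr2 b a : b != 15 -> b != Dist -> m2 b a = m b a.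
  move=> b15 b3; rewrite fr ?inE ?negb_or ?b15 ?b3 //.
  by rewrite /m1 upd_other.
have layerV : eval m2 layerE = dist_layer m k (target i).
  have tE : eval m2 (targetE iE) = target i.
    by apply: target_spec; rewrite ?fr2 // => a; rewrite fr2 // rm.1.
  rewrite /dist_layer -tE /layerE /cellE.
  rewrite -[LHS]/(m2 4 (m2 15 0 * m2 0 0 + eval m2 (targetE iE))).
  by rewrite mk fr2 // (fr2 0) // rm.1.
have -> : sem body m2 = if (0 < dist_layer m k (target i)) &&
    ((m2 Dist i == 0) || (dist_layer m k (target i) < m2 Dist i))
  then upd m2 Dist i (dist_layer m k (target i)) else m2.
  rewrite /body sem_if -layerV.
  rewrite -[eval m2 (EMul _ _)]/(eval m2 layerE *
     (1 - m2 Dist (m2 14 0) + (m2 Dist (m2 14 0) - eval m2 layerE))).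
  rewrite -[sem (SWrite _ _ _) _]/(upd m2 Dist (m2 14 0) (eval m2 layerE)).
  rewrite (fr2 14) // mi; congr (if _ then _ else _).
  by rewrite muln_eq0 addn_eq0; lia.
set d := dist_layer m k (target i) in h2 h3 *.
case: ifPn => [/andP[d0 lt_d]|none].
  split=> [a ai|_|j].
  - by rewrite /upd /= (negPf ai) h1.
  - by exists k => //; rewrite /upd /= eqxx.
  - rewrite /upd /= eqxx ltnS leq_eqVlt => /orP[/eqP->|jk] dj.
      by rewrite d0 leqnn.
    have /andP[x0 xle] := h3 j jk dj.
    by rewrite d0 /=; move: lt_d; rewrite eqn0Ngt x0 /=; lia.
split=> [a ai|+|j]; rewrite upd_other //.
- exact: h1.
- by move=> /h2[j jk e]; exists j => //; apply: ltnW.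
- rewrite ltnS leq_eqVlt => /orP[/eqP->|jk] dj; last exact: h3.
  by move: none; rewrite -/d; move: dj; rewrite -/d; lia.
Qed.

Lemma distances_spec m : ready I m -> (forall v : V, m Used v = 0) ->
  forall i : 'I_(np I), dist_ok i (sem distances_prog m Dist i).
Proof.
move=> rm Um.
pose P k (m2 : memory) := forall i : 'I_(np I), i < k -> dist_ok i (m2 Dist i).
suff h : P (np I) (sem distances_prog m) by move=> i; apply: h.
have nm : eval m npE = np I by rewrite /= rm.1.
rewrite -[X in P X _]nm; apply: sem_for => [//|//|].
move=> k m1; rewrite nm => kn mk fr Pk j.
pose i := Ordinal kn; rewrite upd_other // sem_seq.
have rm1 : ready I m1.
  apply: ready_frame rm _ => b a; case: b => [|[|[|]]] // _ _; by rewrite fr.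
set m2 := sem layers_prog m1.
have rm2 : ready I m2.
  apply: ready_frame rm1 _ => b a; case: b => [|[|[|]]] // _ _; by rewrite /m2 sem_frame.
have m2i : m2 14 0 = i by rewrite /m2 sem_frame.
have [e1 e2 e3] := dist_spec rm2 m2i.
rewrite ltnS leq_eqVlt => /orP[/eqP jk|jk]; last first.
  by rewrite e1 ?(ltn_eqF jk) // /m2 sem_frame //; apply: Pk.
have -> : j = i by exact: val_inj.
have m1i : m1 14 0 = i by [].
have dP := layers_distances rm1 m1i.
have U1 (v : V) : used m1 v = false by rewrite /used fr // Um.
have allU (p : seq V) : all (predC (used m1)) p by apply/allP => v _ /=; rewrite U1.
split=> [d0|p ep lp].
  have [l ln dl] := e2 d0; rewrite dl in d0.
  have [p [ep lp _ _ dp]] := layer_walk dP (ltnW ln) d0.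
  by exists p; rewrite dl -/m2 dp.
(* A simple walk has fewer than [n] arcs, so the rows below [n] suffice. *)
have [q [eq lq uq _ [wq _]]] := shorten_walk weight ep.
have zq : size q < n by have := uniq_size uq.
have := layer_le dP eq (allU _) (ltnW zq); rewrite lq lp => /andP[d0 dle].
have /andP[-> h] := e3 _ zq d0.
by apply: leq_trans h (leq_trans dle _); rewrite ltnS.
Qed.

End Distances.

(** * The greedy algorithm *)

Section Greedy.

Variable I : instance.
Local Notation V := 'I_(nv I).
Local Notation n := (nv I).
Local Notation weight := (@weight I).
Local Notation arc := (@arc I).
Local Notation ww := (walk_weight weight).

(** The layer value at the current vertex plus the weight of the walk traced so far remains
    constant. The trace ends at a vertex with a positive entry in row 0. *)
Lemma trace_spec m (i : 'I_(np I)) k (t : V) (m' := sem trace_prog m) :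
  (forall a, m 0 a = init_mem I 0 a) -> m 13 0 = k -> m 14 0 = i ->
  m Cur 0 = t -> k < n ->
  (forall j (v : V), j < n -> step_ok m j v) -> 0 < dist_layer m k t ->
  exists x p,
  [/\ 0 < dist_layer m 0 x /\ dist_layer m 0 x + ww x p = dist_layer m k t,
      [/\ path arc x p, last x p = t, size p = k & all (predC (used m)) p],
      forall v : V, used m' v = used m v || (v \in p),
      forall b, b < k -> m' Route (i * n + b.+1) = nth 0 (map val p) b &
      forall i' b : nat, i' != i -> b < n -> m' Route (i' * n + b) = m Route (i' * n + b)].
Proof.
move=> inp mk mi mt kn hS d0; rewrite /m' /trace_prog.
set body := SIf _ _ _.
pose P l (m2 : memory) := exists (x : V) (p : seq V),
  [/\ [/\ m2 Cur 0 = x, 0 < dist_layer m (k - l) x &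
         dist_layer m (k - l) x + ww x p = dist_layer m k t],
      [/\ path arc x p, last x p = t, size p = minn l k & all (predC (used m)) p],
      forall v : V, used m2 v = used m v || (v \in p),
      forall b, b < minn l k ->
        m2 Route (i * n + (k - l + b.+1)) = nth 0 (map val p) b &
      forall i' b : nat, i' != i -> b < n -> m2 Route (i' * n + b) = m Route (i' * n + b)].
have nm : eval m nE = n by rewrite /= inp.
suff : P n (sem (SFor 15 nE body) m).
  case=> x [p [[_ dx wp] [ep lp zp Up] hU hr hr']].
  have kn0 : k - n = 0 by lia.
  have knk : minn n k = k by lia.
  rewrite knk kn0 in dx wp zp hr.
  by exists x, p; split=> // b bk; rewrite -hr.
rewrite -[X in P X _]nm; apply: sem_for => [//||].
  exists t, [::]; rewrite subn0 min0n addn0; split=> // v.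
  by rewrite in_nil orbF.
move=> l m2; rewrite nm => ln ml fr [x [p [[cx dx wp] [ep lp zp Up] hU hr hr']]].
have m2E b a : b \notin [:: 15; Route; Used; Cur] -> m2 b a = m b a.
  rewrite !inE !negb_or => /and4P[b15 b8 b6 b9].
  by rewrite fr // /body /= !inE !negb_or b15 b8 b6 b9.
have [lt_lk|le_kl] := ltnP l k; last first.
  have -> : sem body m2 = m2.
    by rewrite /body sem_if /= ml m2E // mk; have -> : k - l = 0 by lia.
  have mE : minn l k = minn l.+1 k by lia.
  have sE : k - l = k - l.+1 by lia.
  exists x, p; rewrite -mE -sE; split=> //.
have [j kl] : exists j, k - l = j.+1 by exists (k - l).-1; lia.
have kl' : k - l.+1 = j by lia.
have jn : j < n by lia.
have mlE : minn l k = l by lia.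
have mlE' : minn l.+1 k = l.+1 by lia.
rewrite kl mlE in dx wp zp hr.
have [[//|u [pu du aux Ux dxE]] _] := hS j x jn.
have -> : sem body m2 = upd (upd (upd m2 Route (i * n + j.+1) x) Used x 1) Cur 0 u.
  rewrite /body sem_if.
  have -> : eval m2 (ESub kE jE) != 0 by rewrite /= ml (m2E 13) // mk kl.
  rewrite -[sem (SSeq _ _) m2]/(upd (upd (upd m2
      Route (m2 14 0 * m2 0 0 + (m2 13 0 - m2 15 0)) (m2 Cur 0)) Used (m2 Cur 0) 1)
      Cur 0 (m2 Pred ((m2 13 0 - m2 15 0) * m2 0 0 + m2 Cur 0))).
  rewrite (m2E 14) // (m2E 13) // (m2E 0) // (m2E Pred) //.
  by rewrite mi mk ml inp input_nv kl cx pu.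
exists u, (x :: p); rewrite mlE' kl'; split.
- by split; rewrite //= addnA -dxE.
- by split; rewrite //= ?aux ?zp ?Ux.
- move=> v; rewrite in_cons orbCA -hU /used /upd /=.
  by rewrite -(inj_eq val_inj) /=; case: ifP.
- move=> b bl; rewrite upd_other // upd_other // upd_other // /upd /=.
  case: b bl => [|b] bl; first by rewrite addn1 eqxx.
  rewrite ifN; first by rewrite /= -hr // addSnnS.
  by rewrite eqn_add2l; lia.
- move=> i' b ii' bn; rewrite upd_other // upd_other // upd_other // /upd /=.
  by rewrite cell_eq ?(negPf ii') ?hr' //; lia.
Qed.

(** Only a walk is obtained here; its simplicity depends on the earlier greedy rounds and is proved
    in [try_spec]. *)
Lemma route_spec m (i : 'I_(np I)) k (m' := sem route_prog m) :
  ready I m -> m 13 0 = k -> m 14 0 = i -> k < n ->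
  (forall v, dist_layer m 0 v = (v == source i) && ~~ used m v) ->
  (forall j (v : V), j < n -> step_ok m j v) ->
  0 < dist_layer m k (target i) ->
  exists p, let q := source i :: p in
  [/\ path arc (source i) p, last (source i) p = target i, size p = k,
      all (predC (used m)) q & (ww (source i) p).+1 = dist_layer m k (target i)] /\
  [/\ forall a : nat, m' Len a = if a == i then k.+1 else m Len a,
      forall v : V, used m' v = used m v || (v \in q),
      forall b, b <= k -> m' Route (i * n + b) = nth 0 (map val q) b &
      forall i' b : nat, i' != i -> b < n -> m' Route (i' * n + b) = m Route (i' * n + b)].
Proof.
move=> rm mk mi kn h0 hS d0; rewrite /m' /route_prog.
rewrite !sem_seq.
set m1 := sem (SWrite Cur _ _) _.
have m1E : m1 = upd (upd m Len i k.+1) Cur 0 (target i).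
  rewrite -(target_spec rm.1 mi) -[k.+1]addn1 -mk.
  rewrite -[m1]/(upd (upd m Len (m 14 0) (m 13 0 + 1)) Cur 0 (eval m (targetE iE))).
  by rewrite mi.
have [|||||||x [p [[dx wp] [ep lp zp Up] hU hr hr']]] := @trace_spec m1 i k (target i).
- by move=> a; rewrite m1E !upd_other // rm.1.
- by rewrite m1E.
- by rewrite m1E.
- by rewrite m1E.
- by [].
- move=> j v jn; have := hS j v jn; rewrite m1E; apply: cell_ok_ext => // u.
- by rewrite m1E.
have xs : x = source i.
  by move: dx; rewrite m1E [dist_layer _ _ _]h0; case: eqP.
rewrite xs {x xs} in dx wp ep lp.
have Us : ~~ used m (source i).
  by move: dx; rewrite m1E [dist_layer _ _ _]h0; case: eqP => // _; case: (used _ _).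
have used1 v : used m1 v = used m v by rewrite m1E.
set m2 := sem trace_prog m1 in hU hr hr' *.
have m2E b a : b \notin [:: 15; Route; Used; Cur] -> m2 b a = m1 b a.
  rewrite !inE !negb_or => /and4P[b15 b8 b6 b9].
  by rewrite /m2 sem_frame //= !inE !negb_or b15 b8 b6 b9.
have inp2 a : m2 0 a = init_mem I 0 a by rewrite m2E // m1E !upd_other // rm.1.
have m2i : m2 14 0 = i by rewrite m2E // m1E.
have srcE (m3 : memory) : (forall a, m3 0 a = init_mem I 0 a) -> m3 14 0 = i ->
  eval m3 (sourceE iE) = source i.
  by move=> r3 m3i; rewrite /= m3i !r3 input_nv (@input_end _ _ 0).
set m3 := sem (SWrite Route _ _) m2.
have m3E : m3 = upd m2 Route (i * n) (source i).
  by rewrite /m3 -(srcE m2) // -m2i -input_nv -inp2 -[_ * _]addn0.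
have -> : sem (SWrite Used (sourceE iE) (EConst 1)) m3 = upd m3 Used (source i) 1.
  by rewrite -(srcE m3) // m3E.
exists p; split; last split.
- split=> //.
    rewrite /= Us; apply/allP => v /(allP Up) /=; by rewrite used1.
  move: wp; rewrite m1E [dist_layer _ 0 _]h0 eqxx Us add1n => ->.
  by [].
- move=> a; rewrite m3E !upd_other // m2E // m1E upd_other //.
- move=> v; rewrite in_cons orbCA -used1 -hU m3E /used /upd /= -(inj_eq val_inj) /=.
  by case: ifP.
- move=> b bk; rewrite m3E upd_other // /upd /= -{2}[i * n]addn0 eqn_add2l.
  by case: b bk => [|b] bk //=; rewrite hr.
- move=> i' b ii' bn; rewrite m3E upd_other // /upd /=.
  rewrite -[i * n]addn0 cell_eq ?(negPf ii') ?hr' ?m1E //; lia.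
Qed.

End Greedy.

Section GreedyLoop.

Variable I : instance.
Local Notation V := 'I_(nv I).
Local Notation n := (nv I).
Local Notation weight := (@weight I).
Local Notation arc := (@arc I).
Local Notation ww := (walk_weight weight).
Implicit Type S : solution I.

Lemma shortest_dist (i : 'I_(np I)) d P : dist_ok i d ->
  shortest_path (source i) (target i) P -> exists p,
    [/\ P = source i :: p, path arc (source i) p, last (source i) p = target i,
        uniq P & (ww (source i) p).+1 = d].
Proof.
move=> [h1 h2] /(shortest_pathP (common_den_gt0 I) (@weightE I))[p [-> ep lp up minp]].
exists p; split=> //; have /andP[d0 dle] := h2 p ep lp.
have [q [eq lq dq]] := h1 d0; have := minp q eq lq; lia.
Qed.

Lemma dist_shortest (i : 'I_(np I)) d p : dist_ok i d -> path arc (source i) p ->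
  last (source i) p = target i -> uniq (source i :: p) ->
  (ww (source i) p).+1 = d -> shortest_path (source i) (target i) (source i :: p).
Proof.
move=> [_ h2] ep lp up dp.
apply/(shortest_pathP (common_den_gt0 I) (@weightE I)); exists p; split=> // q eq lq.
by have /andP[_] := h2 q eq lq; rewrite -dp ltnS.
Qed.

Definition stored S (m : memory) :=
  [/\ forall i : 'I_(np I), m Len i = size (route S i),
      forall (i : 'I_(np I)) b, b < size (route S i) ->
        m Route (i * n + b) = nth 0 (map val (route S i)) b &
      forall v : V, used m v = [exists i, v \in route S i]].

(** The keys [size p * np I + j] order the attempts lexicographically, and all shortest paths with
    keys below [K] are blocked. Round [k] treats paths with [k.+1] vertices. *)
Definition greedy_inv (s K : nat) (m : memory) :=
  [/\ ready I m, forall i : 'I_(np I), dist_ok i (m Dist i) &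
  exists S, [/\ stored S m, feasible S, forall i, size (route S i) <= s &
    forall j p, shortest_path (source j) (target j) p -> size p * np I + j < K ->
      exists i q, [/\ S i = Some q, ~~ [disjoint p & q] & size q <= size p]]].

Lemma greedy_inv_ext s K (m m' : memory) :
  (forall b a, b \in [:: 0; Weight; Dist; Used; Len; Route] -> m' b a = m b a) ->
  greedy_inv s K m -> greedy_inv s K m'.
Proof.
move=> fr [rm dm [S [[h1 h2 h3] fS zS bS]]]; split.
- by apply: ready_frame rm _ => b a; case: b => [|[|[|]]] // _ _; rewrite fr.
- by move=> i; rewrite fr.
- exists S; split=> //; split=> [i|i b bi|v]; rewrite ?fr //; first exact: h2.
  by rewrite /used fr // -h3.
Qed.

Lemma routeE S i v : v \in route S i -> exists2 q, S i = Some q & v \in q.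
Proof. by rewrite /route; case: (S i) => // q vq; exists q. Qed.

Lemma meet_disjoint (p q : seq V) v : v \in p -> v \in q -> ~~ [disjoint p & q].
Proof. by move=> vp vq; apply/negP => /disjointFr/(_ vp); rewrite vq. Qed.

(** Only the shortest paths of pair [i] with [k.+1] vertices are new. They meet the route of [i] in
    its source if there is one, old or new; otherwise each of them meets a used vertex, hence a
    route with at most [k.+1] vertices. *)
Lemma try_spec (m : memory) (i : 'I_(np I)) (k : nat) :
  m 13 0 = k -> m 14 0 = i -> k < n ->
  greedy_inv k.+1 (k.+1 * np I + i) m ->
  greedy_inv k.+1 (k.+1 * np I + i.+1) (sem try_prog m).
Proof.
move=> mk mi kn [rm dm [S [[sL sR sU] fS zS bS]]].
have /feasibleP[pS dS] := fS.
have keyE (j : 'I_(np I)) p : shortest_path (source j) (target j) p ->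
    size p * np I + j < k.+1 * np I + i.+1 ->
    (size p * np I + j < k.+1 * np I + i) \/ (size p = k.+1 /\ j = i).
  move=> _; rewrite addnS ltnS leq_eqVlt => /orP[/eqP/eqP|]; last by left.
  by rewrite cell_eq // => /andP[/eqP-> /eqP /val_inj->]; right.
have srcP (j : 'I_(np I)) p : shortest_path (source j) (target j) p -> source j \in p.
  by move=> /(shortest_dist (dm j))[q [-> _ _ _ _]]; rewrite mem_head.
have same : (forall p, shortest_path (source i) (target i) p -> size p = k.+1 ->
      exists i0 q, [/\ S i0 = Some q, ~~ [disjoint p & q] & size q <= size p]) ->
    greedy_inv k.+1 (k.+1 * np I + i.+1) m.
  move=> hi; split=> //; exists S; split=> // j p sp kp.
  have [|[zp ji]] := keyE j p sp kp; first exact: bS.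
  by rewrite ji in sp; apply: hi.
rewrite /try_prog sem_if; case: ifPn => [|].
  rewrite /= mi sL => Li; apply: same => p sp zp.
  case Si : (S i) => [q|]; last by rewrite /route Si in Li.
  exists i, q; split=> //.
    by apply: (meet_disjoint (srcP _ _ sp)); apply: srcP (pS _ _ Si).
  by have := zS i; rewrite /route Si zp.
rewrite negbK => /eqP Li0; have Li : size (route S i) = 0 by rewrite -sL -mi.
have Si : S i = None.
  case Si : (S i) => [q|] //; have := srcP _ _ (pS _ _ Si).
  by move: Li; rewrite /route Si => /size0nil ->.
rewrite sem_seq; set m1 := sem layers_prog m.
have fr1 b a : b \notin [:: 15; 16; 17; Layer; Pred] -> m1 b a = m b a.
  rewrite !inE !negb_or => /and5P[b15 b16 b17 b4 b5].
  by rewrite /m1 sem_frame //= !inE !negb_or b15 b16 b17 b4 b5.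
have dP := layers_distances rm mi.
set d := dist_layer m1 k (target i).
have inp1 a : m1 0 a = init_mem I 0 a by rewrite fr1 // rm.1.
have m1i : m1 14 0 = i by rewrite fr1.
have m1k : m1 13 0 = k by rewrite fr1.
have topV : eval m1 topE = d.
  rewrite -[LHS]/(m1 4 (m1 13 0 * m1 0 0 + eval m1 (targetE iE))).
  by rewrite (target_spec inp1 m1i) m1k inp1.
have -> : sem (SIf (EMul topE (eqE topE (ERead Dist iE))) route_prog SSkip) m1 =
    if (0 < d) && (d == m Dist i) then sem route_prog m1 else m1.
  rewrite sem_if -[eval m1 (EMul _ _)]/(eval m1 topE *
    (1 - ((eval m1 topE - m1 Dist (m1 14 0)) + (m1 Dist (m1 14 0) - eval m1 topE)))).
  rewrite topV m1i fr1 //; congr (if _ then _ else _).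
  by rewrite muln_eq0 subn_eq0; lia.
have usedS v i0 q : S i0 = Some q -> v \in q -> used m v.
  by move=> S0 vq; rewrite sU; apply/existsP; exists i0; rewrite /route S0.
case: ifPn => [/andP[d0 /eqP dD]|none].
  have [h0 hS] := layers_spec rm mi.
  have rm1 : ready I m1.
    by apply: ready_frame rm _ => b a; case: b => [|[|[|]]] // _ _; rewrite fr1.
  have used1 v : used m1 v = used m v by rewrite /used fr1.
  have h0' v : dist_layer m1 0 v = (v == source i) && ~~ used m1 v.
    by rewrite used1 -h0.
  have [p [[ep lp zp Up wp] [rL rU rR rR']]] := route_spec rm1 m1k m1i kn h0' hS d0.
  set m2 := sem route_prog m1 in rL rU rR rR' *.
  have up : uniq (source i :: p).
    have [q [eq lq uq sq [wq [<- //|zq]]]] := shorten_walk weight ep.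
    rewrite lp in lq; have /andP[_ dq] := (dm i).2 q eq lq.
    have sp : shortest_path (source i) (target i) (source i :: q).
      by apply: (dist_shortest (dm i)) => //; rewrite -dD -/d in dq *; lia.
    have [|i0 [q0 [S0 dq0 _]]] := bS _ _ sp.
      by have := ltn_ord i; rewrite /= zp in zq *; nia.
    case/negP: dq0; apply/pred0P => v /=; apply/negbTE/negP => /andP[vq vq0].
    have := allP Up v; rewrite /= used1 (usedS _ _ _ S0 vq0); move: vq.
    rewrite !inE => /orP[->|/sq->]; rewrite ?orbT; by move=> /(_ isT).
  have sp : shortest_path (source i) (target i) (source i :: p).
    by apply: (dist_shortest (dm i)) => //; rewrite wp.
  have [q qE] : exists q : n.-bseq V, q = source i :: p :> seq V.
    by exists (Bseq (uniq_size up)).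
  pose S' : solution I := [ffun j => if j == i then Some q else S j].
  have S'i : S' i = Some q by rewrite ffunE eqxx.
  have S'j j : j != i -> S' j = S j by rewrite ffunE => /negPf->.
  have r'j j : j != i -> route S' j = route S j by rewrite /route => /S'j->.
  have r'i : route S' i = source i :: p by rewrite /route S'i qE.
  have fr2 b a : b \in [:: 0; Weight; Dist] -> m2 b a = m b a.
    move=> hb; rewrite /m2 sem_frame; first by rewrite fr1 //; move: hb; rewrite !inE; lia.
    by move: hb; rewrite /= !inE; lia.
  have keep i0 q0 : S i0 = Some q0 -> S' i0 = Some q0.
    by move=> S0; rewrite S'j //; apply/eqP => ii; rewrite ii Si in S0.
  split.
  - apply: ready_frame rm _ => b a; case: b => [|[|[|]]] // _ _; by rewrite fr2.
  - by move=> j; rewrite fr2.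
  exists S'; split.
  - split=> [j|j b|v].
    + rewrite rL; have [->|ji] := eqVneq j i; first by rewrite eqxx r'i /= zp.
      by rewrite (inj_eq val_inj) (negPf ji) r'j // fr1.
    + have [->|ji] := eqVneq j i; first by rewrite r'i /= ltnS zp => bk; rewrite rR.
      rewrite r'j // => bj; rewrite rR' //; first by rewrite fr1 // sR.
      by move: bj; rewrite /route; case: (S j) => // r /leq_trans -> //; apply: size_bseq.
    + rewrite rU used1 sU; apply/idP/existsP => [/orP[/existsP[j vj]|vq]|[j]].
      * exists j; rewrite r'j //; apply/eqP => ji; move: vj; rewrite ji /route Si //.
      * by exists i; rewrite r'i.
      * have [->|ji] := eqVneq j i; first by rewrite r'i => ->; rewrite orbT.
        by rewrite r'j // => vj; apply/orP; left; apply/existsP; exists j.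
  - apply/feasibleP; split=> [j r|j j' r r' jj'].
      rewrite ffunE; case: eqP => [-> [<-]|_]; [by rewrite qE | exact: pS].
    have disj r0 j0 : S j0 = Some r0 -> [disjoint q & r0].
      move=> S0; apply/pred0P => v /=; apply/negbTE/negP => /andP[vq vr0].
      move: vq; rewrite -[_ \in q]/(v \in (q : seq V)) qE => /(allP Up) /=.
      by rewrite used1 (usedS _ _ _ S0 vr0).
    have [ji|ji] := eqVneq j i.
      rewrite ji S'i => -[<-]; rewrite S'j; last by rewrite -ji eq_sym.
      exact: disj.
    rewrite (S'j _ ji) => Sj; have [->|j'i] := eqVneq j' i.
      by rewrite S'i => -[<-]; rewrite disjoint_sym; apply: disj Sj.
    by rewrite (S'j _ j'i); apply: dS jj' Sj.
  - move=> j; have [->|ji] := eqVneq j i; first by rewrite r'i /= zp.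
    by rewrite r'j.
  - move=> j r sr kr; have [/(bS _ _ sr)[i0 [q0 [S0 dq0 zq0]]]|[zr ji]] := keyE _ _ sr kr.
      by exists i0, q0; split=> //; apply: keep.
    exists i, q; split=> //; last by rewrite zr qE /= zp.
    rewrite ji in sr; apply: (meet_disjoint (srcP _ _ sr)).
    by rewrite -[_ \in q]/(_ \in (q : seq V)) qE mem_head.
apply: (@greedy_inv_ext _ _ m).
  by move=> b a hb; rewrite fr1 //; move: hb; rewrite !inE; lia.
apply: same => P sp zP.
have [p [PE ep lp up wp]] := shortest_dist (dm i) sp.
have zp : size p = k by move: zP; rewrite PE => -[].
have [/allP Up|/allPn[v vP]] := boolP (all (predC (used m)) P); last first.
  rewrite /= negbK sU => /existsP[i0 /routeE[q S0 vq]].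
  exists i0, q; split=> //; first exact: meet_disjoint vP vq.
  by have := zS i0; rewrite /route S0 zP.
have Up' : all (predC (used m)) (source i :: p) by rewrite -PE; apply/allP.
have zpn : size p <= n by rewrite zp ltnW.
have := layer_le dP ep Up' zpn; rewrite lp zp -/m1 -/d wp => /andP[d0 dle].
have [q [eq lq _ _ dq]] := layer_walk dP (ltnW kn) d0.
have /andP[_] := (dm i).2 q eq lq; rewrite -dq -/m1 -/d => dge.
by move: none; rewrite d0 /= eqn_leq dle dge.
Qed.

End GreedyLoop.

(** * Correctness of the whole program and its output *)

Section Algorithm.

Variable I : instance.
Local Notation V := 'I_(nv I).
Local Notation n := (nv I).
Implicit Type S : solution I.

Lemma greedy_spec m : ready I m -> (forall i : 'I_(np I), dist_ok i (m Dist i)) ->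
  (forall v, m Used v = 0) -> (forall i, m Len i = 0) ->
  exists S, [/\ stored S (sem greedy_prog m), feasible S & blocking S].
Proof.
move=> rm dm Um Lm.
pose P k (m' : memory) := greedy_inv I k (k.+1 * np I) m'.
have nm : eval m nE = n by rewrite /= rm.1.
suff : P n (sem greedy_prog m).
  case=> _ _ [S [stS fS _ bS]]; exists S; split=> // j p sp; apply: (bS _ _ sp).
  have [up _] := shortest_path_uniq sp; have := uniq_size up.
  by have := ltn_ord j; nia.
rewrite -[X in P X _]nm; apply: sem_for => [//||].
  apply: (@greedy_inv_ext _ _ _ m) => [b a hb|].
    by rewrite !upd_other //; move: hb; rewrite !inE; lia.
  split=> //.
  have r0 i : route (empty_solution I) i = [::] by rewrite /route ffunE.
  exists (empty_solution I); split.
  - split=> [i|i b|v]; rewrite ?r0 ?Lm // /used Um.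
    by apply/esym/negbTE/existsPn => i; rewrite r0.
  - exact: feasible_empty.
  - by move=> i; rewrite r0.
  (* Initially only the empty sequence has a key below the bound, and it is not a path. *)
  - by move=> j [|x p] //= sp; rewrite mul1n mulSn -addnA ltnNge leq_addr.
move=> k m1; rewrite nm => kn mk fr Pk.
pose Q c (m2 : memory) := greedy_inv I k.+1 (k.+1 * np I + c) m2 /\ m2 13 0 = k.
have [[inp1 _] _ _] := Pk.
have npm : eval m1 npE = np I by rewrite /= inp1.
suff : Q (np I) (sem (SFor 14 npE try_prog) m1).
  case=> Qn _; apply: (@greedy_inv_ext _ _ _ (sem (SFor 14 npE try_prog) m1)) => [b a hb|].
    by rewrite upd_other //; move: hb; rewrite !inE; lia.
  by rewrite mulSn addnC.
rewrite -[X in Q X _]npm; apply: sem_for => [//||].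
  split; last by [].
  apply: (@greedy_inv_ext _ _ _ m1) => [b a hb|].
    by rewrite !upd_other //; move: hb; rewrite !inE; lia.
  rewrite addn0; case: Pk => rm1 dm1 [S [stS fS zS bS]]; split=> //.
  by exists S; split=> // i; apply: leq_trans (zS i) _.
move=> c m2; rewrite npm => cn mc fr2 [Qc m2k]; split; last first.
  by rewrite upd_other // sem_frame.
apply: (@greedy_inv_ext _ _ _ (sem try_prog m2)) => [b a hb|].
  by rewrite upd_other //; move: hb; rewrite !inE; lia.
exact: (@try_spec _ m2 (Ordinal cn)).
Qed.

Definition written (w : seq nat) (m : memory) :=
  m Pos 0 = size w /\ forall a, a < size w -> m Out a = nth 0 w a.

Lemma emit_spec w m e : written w m -> written (rcons w (eval m e)) (sem (emit e) m).
Proof.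
move=> [h1 h2]; split.
  by rewrite size_rcons -h1 /= addn1 /upd /=.
move=> a; rewrite size_rcons ltnS leq_eqVlt nth_rcons => /orP[/eqP->|aw].
  by rewrite ltnn eqxx -h1 /= /upd /= eqxx.
by rewrite aw -h2 //= upd_other // /upd /= h1 ltn_eqF.
Qed.

Lemma output_spec S m : (forall a, m 0 a = init_mem I 0 a) -> stored S m ->
  m Pos 0 = 0 -> output (sem output_prog m) S.
Proof.
move=> inp [sL sR _] m0.
pose block i := size (route S i) :: map val (route S i).
pose blocks := [seq block i | i <- enum 'I_(np I)].
have encE : encode_solution S = flatten blocks.
  congr flatten; apply: eq_map => i; rewrite /block /route.
  by case: (S i).
have szb : size blocks = np I by rewrite (size_map _ (enum _)) size_enum_ord.
pose P k (m' : memory) := written (flatten (take k blocks)) m'.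
have npm : eval m npE = np I by rewrite /= inp.
suff : P (np I) (sem output_prog m).
  by case=> _ h a; rewrite encE => ha; rewrite h take_oversize ?szb.
rewrite -[X in P X _]npm; apply: sem_for => [//||]; first by rewrite /P take0.
move=> k m1; rewrite npm => kn mk fr Pk; pose i := Ordinal kn.
have fr1 b a : b \notin [:: Out; Pos; 14; 15] -> m1 b a = m b a.
  by rewrite !inE !negb_or => /and4P[b1 b2 b3 b4]; rewrite fr // !inE !negb_or b1 b2 b3 b4.
pose w := rcons (flatten (take k blocks)) (size (route S i)).
rewrite sem_seq; set m2 := sem (emit _) m1.
have w2 : written w m2.
  have := emit_spec (ERead Len iE) Pk.
  by have -> : eval m1 (ERead Len iE) = size (route S i) by rewrite /= mk fr1 // -sL.
have fr2 b a : b \notin [:: Out; Pos; 14; 15] -> m2 b a = m b a.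
  move=> hb; rewrite /m2 sem_frame ?fr1 //.
  by move: hb; rewrite !inE !negb_or => /and4P[-> -> _ _].
have m2k : m2 14 0 = k by rewrite /m2 sem_frame.
have nm2 : eval m2 nE = n by rewrite /= fr2 // inp.
pose r := map val (route S i).
pose Q j (m' : memory) := written (w ++ take j r) m'.
set body := SIf _ _ _.
suff : Q n (sem (SFor 15 nE body) m2).
  have zr : size r <= n.
    by rewrite size_map /route; case: (S i) => // p; apply: size_bseq.
  rewrite /Q take_oversize // => -[h1 h2].
  have wE : w ++ r = flatten (take k.+1 blocks).
    rewrite (take_nth [::]) ?szb // -cats1 flatten_cat /= cats0 /w cat_rcons.
    by rewrite (nth_map i) ?size_enum_ord // (nth_ord_enum i i).
  by rewrite /P -wE; split=> [|a ha]; rewrite upd_other // h2.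
rewrite -[X in Q X _]nm2; apply: sem_for => [//||].
  by rewrite /Q take0 cats0.
move=> j m3; rewrite nm2 => jn mj fr' Qj.
have fr3 b a : b \notin [:: Out; Pos; 14; 15] -> m3 b a = m b a.
  move=> hb; rewrite fr' ?fr2 //; move: hb; rewrite !inE !negb_or => /and4P[b1 b2 _ b4].
  by rewrite b1 b2 b4.
have m3k : m3 14 0 = k by rewrite fr'.
have -> : sem body m3 = if j < size r then sem (emit (ERead Route (cellE iE jE))) m3 else m3.
  rewrite /body sem_if.
  rewrite -[eval m3 (ESub _ _)]/(m3 Len (m3 14 0) - m3 15 0) m3k fr3 // mj.
  by rewrite (sL i) size_map subn_eq0 -ltnNge.
case: ifP => jr.
  have := emit_spec (ERead Route (cellE iE jE)) Qj.
  have -> : eval m3 (ERead Route (cellE iE jE)) = nth 0 r j.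
    rewrite /= m3k mj (fr3 0) // (fr3 8) // inp input_nv.
    by rewrite (sR i) //; rewrite size_map in jr.
  by rewrite rcons_cat -take_nth.
have rj : size r <= j by rewrite leqNgt jr.
by move: Qj; rewrite /Q !take_oversize ?(leqW rj).
Qed.

Lemma algorithm_spec : exists S,
  [/\ output (sem algorithm (init_mem I)) S, feasible S & blocking S].
Proof.
set m0 := init_mem I; rewrite /algorithm !sem_seq.
set m1 := sem weights_prog m0; set m2 := sem distances_prog m1.
set m3 := sem greedy_prog m2.
have rm1 : ready I m1.
  by split=> [a|u v]; [rewrite /m1 sem_frame | apply: weights_spec].
have fr2 b a : b \in [:: 0; Weight; Used; Len; Pos] -> m2 b a = m1 b a.
  by rewrite !inE /m2 => hb; rewrite sem_frame //= !inE; lia.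
have fr1 b a : b \in [:: Used; Len; Pos] -> m1 b a = 0.
  by rewrite !inE /m1 => hb; rewrite sem_frame ?inE; [case: b hb | lia].
have rm2 : ready I m2.
  by apply: ready_frame rm1 _ => b a; case: b => [|[|[|]]] // _ _; rewrite fr2.
have [i|v|i|S [stS fS bS]] := @greedy_spec m2 rm2.
- by apply: distances_spec => // u; rewrite fr1.
- by rewrite fr2 ?fr1.
- by rewrite fr2 ?fr1.
exists S; split=> //; apply: output_spec stS _.
  by move=> a; rewrite /m3 sem_frame // rm2.1.
by rewrite /m3 sem_frame // fr2 ?fr1.
Qed.

End Algorithm.

(** Otherwise [k >= g * r + 1] by integrality, so [k * (k - g)] exceeds [g * r ^ 2], against
    [k * (k - g) <= g * l]. This use of integrality is why the square root is rounded up. *)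
Lemma ratio_arcs k g l r : 0 < r -> l <= r ^ 2 -> k ^ 2 <= g * (l + k) -> k <= g * r.
Proof.
move=> r0; rewrite -!mulnn => lr kg; rewrite leqNgt; apply/negP => lt_k.
have [g' gE] : exists g', g = g'.+1 by exists g.-1; nia.
have [r' rE] : exists r', r = r'.+1 by exists r.-1; lia.
have [d kE] : exists d, k = g * r + d.+1 by exists (k - g * r).-1; lia.
have : g * l <= g * (r * r) by rewrite leq_mul2l lr orbT.
by subst; nia.
Qed.

Local Open Scope ring_scope.

Theorem theorem3 (R : realType) :
  exists c : prog,
    polynomial_time c /\
    approximation_factor c (fun I : instance =>
      Num.min (Num.sqrt (nv I)%:R : R)
              (Num.ceil (Num.sqrt ((min_opt_arcs I)%:R : R)))%:~R).
Proof.
have [P runs] := @polynomial_time_compile level 200 5 erefl level_leq isT _ good_algorithm.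
exists (compile algorithm); split=> // I m t rm.
have [t' rt'] := runs I; rewrite (run_deterministic rm rt').
have [S [oS fS bS]] := algorithm_spec I; exists S; split=> //.
have [[T /andP[fT /eqP vT] aT] _] := min_opt_arcsP I.
have := blocking_value fS bS fT; have := vertices_leq fT; rewrite vT aT.
set k := opt I; set l := min_opt_arcs I; set g := value S => lkn kg.
set a := Num.sqrt _; set b := _%:~R.
have [k0|k_gt0] := posnP k; first by rewrite k0 mul0r.
(* Here [k ^ 2 <= g * (l + k) <= g * n <= g ^ 2 * n], where [k > 0] forces [g > 0]. *)
have ka : k%:R <= g%:R * a.
  rewrite -(@ler_pXn2r _ 2) ?nnegrE ?mulr_ge0 ?sqrtr_ge0 //.
  rewrite exprMn sqr_sqrtr // -!natrX -natrM ler_nat.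
  apply: (leq_trans kg); rewrite -mulnn -mulnA leq_mul2l; apply/orP; right.
  apply: (leq_trans lkn); rewrite leq_pmull //.
  by rewrite lt0n; apply: contraTneq kg => ->; rewrite mul0n -ltnNge expn_gt0 k_gt0.
(* If the ceiling is not positive, neither is the minimum, and the quotient is at most 0, also under
   the convention for division by zero. *)
have [b_le0|b_gt0] := lerP b 0.
  apply: le_trans (_ : 0 <= _) => //.
  by rewrite mulr_ge0_le0 // invr_le0 ge_min b_le0 orbT.
have kb : k%:R <= g%:R * b.
  have [r rE] : exists r : nat, b = r%:R.
    by exists `|Num.ceil (Num.sqrt (l%:R : R))|%N; rewrite natr_absz ger0_norm // -(ler0z R) ltW.
  rewrite rE -natrM ler_nat; apply: ratio_arcs kg; first by rewrite -(ltr0n R) -rE.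
  rewrite -(ler_nat R) natrX -rE -(@sqr_sqrtr _ (l%:R : R)) //.
  by rewrite ler_pXn2r ?nnegrE ?sqrtr_ge0 ?(ltW b_gt0) // ceil_ge.
have a_gt0 : 0 < a by rewrite sqrtr_gt0 ltr0n; lia.
rewrite ler_pdivrMr; first by rewrite minr_pMr // le_min ka kb.
by rewrite lt_min a_gt0.
Qed.
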